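(* Let $U$ be a Hopf algebra, $H\subseteq U$ a right coideal subalgebra and $C=U/UH^+$. Assume that $U$ is faithfully flat as a left and as a right $H$-module. Then the assignment $T\mapsto(\mathscr{W}_1^T,\delta^T)$, where $\mathscr{W}_1^T:=U\otimes_HT$ and $\delta^T(x\otimes_Ht)=xt$, induces a bijection between the set of quantum tangent spaces $T\subseteq C^+$ and the set of isomorphism classes of $U$-equivariant first-order codifferential calculi $(\mathscr{W}_1,\delta)$ over $C$.
   Context: Throughout, $k$ is a field with $\mathrm{char}(k)\ne2$; everything is over $k$. A right coideal subalgebra is a subalgebra $H\subseteq U$ with $\Delta(H)\subseteq H\otimes U$; $H^+=\ker(\varepsilon|_H)$. $C=U/UH^+\cong U\otimes_Hk$ is a quotient coalgebra of $U$ and a left $U$-module coalgebra via $x[y]=[xy]$, where $[y]$ is the class of $y$. $C^+=\ker(\varepsilon\colon C\to k)$ and $c^+=c-\varepsilon(c)[1]$. In a $C$-bicomodule $W$ write $w\mapsto w_{(-1)}\otimes w_{(0)}$ and $w\mapsto w_{(0)}\otimes w_{(1)}$ for the left and right coactions. A coderivation is a linear map $\delta\colon W\to C$ with $\Delta(\delta(w))=\delta(w_{(0)})\otimes w_{(1)}+w_{(-1)}\otimes\delta(w_{(0)})$. A first-order codifferential calculus (FOCC) over $C$ is a $C$-bicomodule $\mathscr{W}_1$ with a coderivation $\delta\colon\mathscr{W}_1\to C$ such that $w\mapsto w_{(-1)}\otimes\delta(w_{(0)})\in C\otimes C$ is injective. It is $U$-equivariant if $\mathscr{W}_1$ is in addition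 a left $U$-module with $(xw)_{(-1)}\otimes(xw)_{(0)}=x_{(1)}w_{(-1)}\otimes x_{(2)}w_{(0)}$ and $(xw)_{(0)}\otimes(xw)_{(1)}=x_{(1)}w_{(0)}\otimes x_{(2)}w_{(1)}$ for $x\in U$, and $\delta$ is $U$-linear. Isomorphisms of equivariant FOCCs over $C$ are $U$-linear, $C$-bicolinear bijections commuting with the coderivations. A quantum tangent space is a subspace $T\subseteq C^+$ with $\Delta(T)\subseteq(T\oplus k[1])\otimes C$ and $HT\subseteq T$. It carries the right $C$-coaction $t\mapsto t_{(1)}^+\otimes t_{(2)}$ (written $t_{(0)}\otimes t_{(1)}$ below as a coaction). On $U\otimes_HT$ the left $U$-action is by left multiplication, the left $C$-coaction is $x\otimes_Ht\mapsto[x_{(1)}]\otimes(x_{(2)}\otimes_Ht)$, and the right $C$-coaction is $x\otimes_Ht\mapsto(x_{(1)}\otimes_Ht_{(0)})\otimes x_{(2)}t_{(1)}$. *)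

(* Defs.v *)
From HB Require Import structures.
From mathcomp Require Import all_boot all_algebra.
From mathcomp Require Import boolp classical_sets functions.
From mathcomp Require Import freeg.

Set Implicit Arguments.
Unset Strict Implicit.
Unset Printing Implicit Defensive.

Import GRing.Theory.
Local Open Scope ring_scope.
Local Open Scope quotient_scope.
Local Open Scope classical_set_scope.

(* [V ⊗ W] is the tensor product of spaces over the base field, [v \ot w] an
   elementary tensor. *)
Reserved Notation "V ⊗ W" (at level 40, left associativity).
Reserved Notation "v \ot w" (at level 40, left associativity).

(* Locked, so that simplification does not unfold the maps built below. *)
HB.lock Definition mkLinear (R : nzRingType) (V W : lmodType R) (f : V -> W)
    (h : linear f) : {linear V -> W} :=
  HB.pack f (GRing.isLinear.Build R V W *:%R f h).

HB.lock Definition mkBilinear (R : nzRingType) (V W X : lmodType R)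
    (f : V -> W -> X) (hl : forall w, linear (f^~ w))
    (hr : forall v, linear (f v)) : {bilinear V -> W -> X} :=
  HB.pack f (bilinear_isBilinear.Build R V W X *:%R *:%R f (pair hl hr)).

Lemma mkLinearE (R : nzRingType) (V W : lmodType R) (f : V -> W)
  (h : linear f) : mkLinear h = f :> (V -> W).
Proof. by rewrite mkLinear.unlock. Qed.

Lemma mkBilinearE (R : nzRingType) (V W X : lmodType R) (f : V -> W -> X)
  (hl : forall w, linear (f^~ w)) (hr : forall v, linear (f v)) :
  mkBilinear hl hr = f :> (V -> W -> X).
Proof. by rewrite mkBilinear.unlock. Qed.

Section Span.
Variables (k : fieldType) (V : lmodType k) (P : set V).

Inductive in_span : V -> Prop :=
| InSpan0 : in_span 0
| InSpanP a u v : P u -> in_span v -> in_span (a *: u + v).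

Definition span : {pred V} := fun v => `[< in_span v >].

Lemma spanP v : reflect (in_span v) (v \in span).
Proof. exact: asboolP. Qed.

Lemma mem_span v : P v -> v \in span.
Proof.
by move=> Pv; apply/spanP; rewrite -[v]addr0 -[v]scale1r; do !constructor.
Qed.

Lemma span_submod_closed : GRing.submod_closed span.
Proof.
split=> [|a u v /spanP u_in /spanP v_in]; apply/spanP; first by constructor.
elim: u_in => [|b w u' Pw _ IHu]; first by rewrite scaler0 add0r.
by rewrite scalerDr scalerA -addrA; constructor.
Qed.

HB.instance Definition _ := GRing.isSubmodClosed.Build k V span
  span_submod_closed.

Lemma span_ind_linear (Q : V -> Prop) : Q 0 ->
  (forall a u v, Q u -> Q v -> Q (a *: u + v)) -> (forall v, P v -> Q v) ->
  forall v, v \in span -> Q v.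
Proof.
move=> Q0 Ql QP v /spanP; elim=> // a u w Pu _ Qw.
by apply: Ql => //; exact: QP.
Qed.

End Span.

(* The quotient of V by the subspace spanned by P. *)
Section LinearQuotient.
Variables (k : fieldType) (V : lmodType k) (P : set V).

Definition lquot := Quotient.quot (span P).
HB.instance Definition _ := GRing.Zmodule.on lquot.

Let pi_ind (Q : lquot -> Prop) :
  (forall v, Q (\pi_(Quotient.quot (span P)) v)) -> forall q, Q q.
Proof. by move=> h q; rewrite -[q](@reprK _ (Quotient.quot (span P))). Qed.

Definition lrepr (q : lquot) : V := repr (q : Quotient.quot (span P)).

Definition lquot_scale (a : k) (q : lquot) : lquot :=
  \pi_(Quotient.quot (span P)) (a *: lrepr q).

Lemma lquot_scale_pi a v :
  lquot_scale a (\pi_(Quotient.quot (span P)) v) =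
  \pi_(Quotient.quot (span P)) (a *: v).
Proof.
apply/eqP; rewrite -Quotient.idealrBE -scalerBr rpredZ //.
by rewrite Quotient.idealrBE reprK.
Qed.

Lemma lquot_scaleA a b q :
  lquot_scale a (lquot_scale b q) = lquot_scale (a * b) q.
Proof.
elim/pi_ind: q => v.
by rewrite !lquot_scale_pi scalerA.
Qed.

Lemma lquot_scale1 : left_id 1 lquot_scale.
Proof. by elim/pi_ind => v; rewrite lquot_scale_pi scale1r. Qed.

Lemma lquot_scaleDr : right_distributive lquot_scale +%R.
Proof.
move=> a; elim/pi_ind => u; elim/pi_ind => v.
by rewrite -raddfD !lquot_scale_pi -raddfD scalerDr.
Qed.

Lemma lquot_scaleDl q : {morph lquot_scale^~ q : a b / a + b}.
Proof.
by elim/pi_ind: q => v a b; rewrite !lquot_scale_pi -raddfD scalerDl.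
Qed.

HB.instance Definition _ := GRing.Zmodule_isLmodule.Build k lquot
  lquot_scaleA lquot_scale1 lquot_scaleDr lquot_scaleDl.

Let lpi_fun (v : V) : lquot := \pi_(Quotient.quot (span P)) v.
Let lpi_linear : linear lpi_fun.
Proof. by move=> a u v; rewrite /lpi_fun raddfD /= -lquot_scale_pi. Qed.

Definition lpi : {linear V -> lquot} := mkLinear lpi_linear.

Let lpiE v : lpi v = \pi_(Quotient.quot (span P)) v.
Proof. by rewrite /lpi mkLinearE. Qed.

Lemma lpiK q : lpi (lrepr q) = q.
Proof. by rewrite lpiE; apply: reprK. Qed.

Lemma lpi_eq0 v : (lpi v == 0) = (v \in span P).
Proof.
by rewrite -(linear0 lpi) -[in RHS](subr0 v) Quotient.idealrBE !lpiE.
Qed.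

Lemma lquotW (Q : lquot -> Prop) : (forall v, Q (lpi v)) -> forall q, Q q.
Proof. by move=> h q; rewrite -(lpiK q). Qed.

Variables (W : lmodType k) (f : {linear V -> W}) (fP : forall v, P v -> f v = 0).

Lemma lker_span v : v \in span P -> f v = 0.
Proof.
apply: (span_ind_linear (Q := fun v => f v = 0)) => // [|a u w fu fw].
  exact: raddf0.
by rewrite linearP fu fw scaler0 addr0.
Qed.

Let qlift_fun (q : lquot) := f (lrepr q).
Let qlift_funE v : qlift_fun (lpi v) = f v.
Proof.
apply/eqP; rewrite -subr_eq0 -raddfB; apply/eqP/lker_span.
by rewrite -lpi_eq0 linearB lpiK subrr.
Qed.
Let qlift_linear : linear qlift_fun.
Proof.
move=> a; elim/lquotW => u; elim/lquotW => v.
by rewrite -linearP !qlift_funE linearP.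
Qed.

Definition qlift : {linear lquot -> W} := mkLinear qlift_linear.

Lemma qliftE v : qlift (lpi v) = f v.
Proof. by rewrite /qlift mkLinearE qlift_funE. Qed.

End LinearQuotient.

Section Tensor.
Variables (k : fieldType) (V W : lmodType k).

Definition fpair (v : V) (w : W) : {freeg (V * W) / k} := << (v, w) >>.

Inductive bilin_rel : {freeg (V * W) / k} -> Prop :=
| BilinRelL a u v w : bilin_rel (fpair (a *: u + v) w - (a *: fpair u w + fpair v w))
| BilinRelR a v w x : bilin_rel (fpair v (a *: w + x) - (a *: fpair v w + fpair v x)).

Definition tensor := lquot bilin_rel.
HB.instance Definition _ := GRing.Lmodule.on tensor.

Let tens_fun v w : tensor := lpi bilin_rel (fpair v w).
Let tens_linl w : linear (tens_fun^~ w).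
Proof.
move=> a u v; apply/eqP; rewrite -subr_eq0 /tens_fun -linearP -raddfB lpi_eq0.
exact/mem_span/BilinRelL.
Qed.
Let tens_linr v : linear (tens_fun v).
Proof.
move=> a u w; apply/eqP; rewrite -subr_eq0 /tens_fun -linearP -raddfB lpi_eq0.
exact/mem_span/BilinRelR.
Qed.

Definition tens : {bilinear V -> W -> tensor} := mkBilinear tens_linl tens_linr.

Let tensE v w : tens v w = lpi bilin_rel (fpair v w).
Proof. by rewrite /tens mkBilinearE. Qed.

Lemma tensor_ind (Q : tensor -> Prop) : Q 0 ->
  (forall x y, Q x -> Q y -> Q (x + y)) -> (forall v w, Q (tens v w)) ->
  forall x, Q x.
Proof.
move=> Q0 QD Qt; elim/lquotW => z; rewrite -(freeg_sumE z) linear_sum.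
elim/big_ind: _ => // [[v w] _]; set c := coeff _ _.
have -> : << c *g (v, w) >> = c *: fpair v w :> {freeg (V * W) / k}.
  by apply/eqP/freeg_eqP => x; rewrite coeffZ !coeffU mul1r.
have -> : lpi bilin_rel (c *: fpair v w) = tens (c *: v) w.
  by rewrite linearZ_LR linearZl_LR tensE.
exact: Qt.
Qed.

End Tensor.

Notation "V ⊗ W" := (tensor V W) : type_scope.
Notation "V ⊗ W" := (tensor V W) (only parsing) : ring_scope.
Notation "v \ot w" := (tens _ _ v w) : ring_scope.

Section TensorTheory.
Variable k : fieldType.

Section Ext.
Variables V W X : lmodType k.

Lemma tensor_ext (f g : {linear V ⊗ W -> X}) :
  (forall v w, f (v \ot w) = g (v \ot w)) -> f =1 g.
Proof.
move=> fg; apply: tensor_ind => [|x y fx fy|//]; first by rewrite !linear0.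
by rewrite !linearD fx fy.
Qed.

Variable f : {bilinear V -> W -> X}.

Let free_lift : {freeg (V * W) / k} -> X := fglift (fun p => f p.1 p.2).
Let free_liftD x y : free_lift (x + y) = free_lift x + free_lift y.
Proof.
rewrite -(freeg_repr x) -(freeg_repr y) -freeg_cat /free_lift !fglift_Freeg.
exact: prelift_cat.
Qed.
Let free_liftU a p : free_lift << a *g p >> = a *: f p.1 p.2.
Proof. exact: liftU. Qed.
Let free_lift0 : free_lift 0 = 0.
Proof. by apply: (addIr (free_lift 0)); rewrite -free_liftD !add0r. Qed.
Let free_lift_sum (s : seq (V * W)) (c : V * W -> k) :
  free_lift (\sum_(p <- s) << c p *g p >>) = \sum_(p <- s) c p *: f p.1 p.2.
Proof.
elim: s => [|p s IHs]; first by rewrite !big_nil free_lift0.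
by rewrite !big_cons free_liftD free_liftU IHs.
Qed.
Let free_liftZ a x : free_lift (a *: x) = a *: free_lift x.
Proof.
have {1}-> : a *: x = \sum_(p <- dom x) << a * coeff p x *g p >>.
  rewrite -[in LHS](freeg_sumE x) scaler_sumr; apply: eq_bigr => p _.
  by apply/eqP/freeg_eqP => q; rewrite coeffZ !coeffU mulrA.
rewrite -[in RHS](freeg_sumE x) !free_lift_sum scaler_sumr.
by apply: eq_bigr => p _; rewrite scalerA.
Qed.
Let free_lift_linear : linear free_lift.
Proof. by move=> a u v; rewrite free_liftD free_liftZ. Qed.
Let free_liftP z : bilin_rel z -> mkLinear free_lift_linear z = 0.
Proof.
have E v w : free_lift (fpair v w) = f v w by rewrite free_liftU scale1r.
case=> *; rewrite linearB linearP; apply/eqP; rewrite subr_eq0; apply/eqP.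
  by rewrite mkLinearE !E -linearPl.
by rewrite mkLinearE !E -linearPr.
Qed.

Definition tlift : {linear V ⊗ W -> X} := qlift free_liftP.

Lemma tliftE v w : tlift (v \ot w) = f v w.
Proof. by rewrite /tens mkBilinearE [LHS]qliftE mkLinearE free_liftU scale1r. Qed.

End Ext.

Section Map.
Variables (V V' W W' : lmodType k).
Variables (f : {linear V -> V'}) (g : {linear W -> W'}).

Let tmap_linl w : linear (fun v => f v \ot g w).
Proof. by move=> a u v; rewrite linearP linearPl. Qed.
Let tmap_linr v : linear (fun w => f v \ot g w).
Proof. by move=> a u w; rewrite linearP linearPr. Qed.

Definition tmap : {linear V ⊗ W -> V' ⊗ W'} :=
  tlift (mkBilinear tmap_linl tmap_linr).

Lemma tmapE v w : tmap (v \ot w) = f v \ot g w.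
Proof. by rewrite [LHS]tliftE mkBilinearE. Qed.

End Map.

(* tmap2 f g (a \ot b) (m \ot n) = f a m \ot g b n. For multiplications or
   actions f and g, tmap2 f g (comul x) (m \ot n) is x_(1) m ⊗ x_(2) n. *)
Section Map2.
Variables (A B M N X Y : lmodType k).
Variables (f : {bilinear A -> M -> X}) (g : {bilinear B -> N -> Y}).

Let pre z a b := tmap (f a) (g b) z.
Let pre_linl z b : linear (pre z ^~ b).
Proof.
move=> c a a'; rewrite /pre; elim/tensor_ind: z => [|x y|m n].
- by rewrite !linear0 addr0.
- by rewrite !linearD => -> ->; rewrite addrACA.
by rewrite !tmapE /= !linearPl.
Qed.
Let pre_linr z a : linear (pre z a).
Proof.
move=> c b b'; rewrite /pre; elim/tensor_ind: z => [|x y|m n].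
- by rewrite !linear0 addr0.
- by rewrite !linearD => -> ->; rewrite addrACA.
by rewrite !tmapE /= linearPl linearPr.
Qed.

Let tmap2_fun s z := tlift (mkBilinear (pre_linl z) (pre_linr z)) s.
Let tmap2_linl z : linear (tmap2_fun^~ z).
Proof. by move=> a s s'; rewrite /tmap2_fun linearP. Qed.
Let tmap2_linr s : linear (tmap2_fun s).
Proof.
move=> a z z'; rewrite /tmap2_fun; elim/tensor_ind: s => [|x y|u v].
- by rewrite !linear0 addr0.
- by rewrite !linearD => -> ->; rewrite addrACA.
by rewrite !tliftE !mkBilinearE /pre linearP.
Qed.

Definition tmap2 : {bilinear A ⊗ B -> M ⊗ N -> X ⊗ Y} :=
  mkBilinear tmap2_linl tmap2_linr.

Lemma tmap2E a b m n : tmap2 (a \ot b) (m \ot n) = f a m \ot g b n.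
Proof. by rewrite /tmap2 mkBilinearE [LHS]tliftE mkBilinearE [LHS]tmapE. Qed.

End Map2.

Section Assoc.
Variables (V W X : lmodType k).

Let assoc1 x v w := v \ot (w \ot x) : V ⊗ (W ⊗ X).
Let assoc1_linl x w : linear (assoc1 x ^~ w).
Proof. by move=> a u v; rewrite /assoc1 linearPl. Qed.
Let assoc1_linr x v : linear (assoc1 x v).
Proof. by move=> a u w; rewrite /assoc1 linearPl linearPr. Qed.
Let assoc2 z x := tlift (mkBilinear (assoc1_linl x) (assoc1_linr x)) z.
Let assoc2_linl x : linear (assoc2 ^~ x).
Proof. by move=> a y z; rewrite /assoc2 linearP. Qed.
Let assoc2_linr z : linear (assoc2 z).
Proof.
move=> a x y; rewrite /assoc2; elim/tensor_ind: z => [|s t|u v].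
- by rewrite !linear0 addr0.
- by rewrite !linearD => -> ->; rewrite addrACA.
by rewrite !tliftE !mkBilinearE /assoc1 !linearPr.
Qed.

Definition tassoc : {linear (V ⊗ W) ⊗ X -> V ⊗ (W ⊗ X)} :=
  tlift (mkBilinear assoc2_linl assoc2_linr).

Lemma tassocE v w x : tassoc ((v \ot w) \ot x) = v \ot (w \ot x).
Proof. by rewrite [LHS]tliftE mkBilinearE [LHS]tliftE mkBilinearE. Qed.

End Assoc.

(* e ⊗ id : V ⊗ W -> k ⊗ W = W, and id ⊗ e. *)
Section Contract.
Variables (V W : lmodType k).

Let contrl_linl (e : {scalar V}) (w : W) : linear (fun v => e v *: w).
Proof. by move=> a u v; rewrite linearP scalerDl scalerA. Qed.
Let contrl_linr (e : {scalar V}) v : linear (fun w : W => e v *: w).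
Proof. by move=> a u w; rewrite scalerDr !scalerA mulrC. Qed.
Definition contractl (e : {scalar V}) : {linear V ⊗ W -> W} :=
  tlift (mkBilinear (contrl_linl e) (contrl_linr e)).

Lemma contractlE e v w : contractl e (v \ot w) = e v *: w.
Proof. by rewrite [LHS]tliftE mkBilinearE. Qed.

Let contrr_linl (e : {scalar W}) w : linear (fun v : V => e w *: v).
Proof. by move=> a u v; rewrite scalerDr !scalerA mulrC. Qed.
Let contrr_linr (e : {scalar W}) (v : V) : linear (fun w => e w *: v).
Proof. by move=> a u w; rewrite linearP scalerDl scalerA. Qed.
Definition contractr (e : {scalar W}) : {linear V ⊗ W -> V} :=
  tlift (mkBilinear (contrr_linl e) (contrr_linr e)).

Lemma contractrE e v w : contractr e (v \ot w) = e w *: v.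
Proof. by rewrite [LHS]tliftE mkBilinearE. Qed.

End Contract.

Section Mul.
Variable A : algType k.
Let mul_linl (y : A) : linear (fun x : A => x * y).
Proof. by move=> a u v; rewrite mulrDl scalerAl. Qed.
Let mul_linr (x : A) : linear (fun y : A => x * y).
Proof. by move=> a u v; rewrite mulrDr scalerAr. Qed.
Definition bmul : {bilinear A -> A -> A} := mkBilinear mul_linl mul_linr.

Lemma bmulE x y : bmul x y = x * y.
Proof. by rewrite /bmul mkBilinearE. Qed.
End Mul.

End TensorTheory.

#[global] Opaque tensor tens tlift tmap tmap2 tassoc contractl contractr bmul.

HB.mixin Record isCoalgebra (k : fieldType) C of GRing.Lmodule k C := {
  comul : {linear C -> C ⊗ C};
  counit : {scalar C};
  comulA : forall c : C,
    tassoc C C C (tmap comul idfun (comul c)) = tmap idfun comul (comul c);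
  counitl : forall c : C, contractl C counit (comul c) = c;
  counitr : forall c : C, contractr C counit (comul c) = c
}.

#[short(type="coalgType")]
HB.structure Definition Coalgebra (k : fieldType) :=
  { C of isCoalgebra k C & GRing.Lmodule k C }.

HB.mixin Record isHopfAlgebra (k : fieldType) U
    of GRing.Algebra k U & Coalgebra k U := {
  comul1 : comul (1 : U) = 1 \ot 1 ;
  comulM : forall x y : U, comul (x * y) = tmap2 (bmul U) (bmul U) (comul x) (comul y);
  counit1 : counit (1 : U) = 1 ;
  counitM : forall x y : U, counit (x * y) = counit x * counit y;
  antipode : {linear U -> U};
  antipodel : forall x : U, tlift (bmul U) (tmap antipode idfun (comul x)) = (counit x)%:A;
  antipoder : forall x : U, tlift (bmul U) (tmap idfun antipode (comul x)) = (counit x)%:A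
}.

#[short(type="hopfAlgType")]
HB.structure Definition HopfAlgebra (k : fieldType) :=
  { U of isHopfAlgebra k U & GRing.Algebra k U & Coalgebra k U }.

Section MoreTensor.
Variable k : fieldType.

Lemma tmap_comp (V V' V'' W W' W'' : lmodType k) (f : {linear V -> V'})
  (f' : {linear V' -> V''}) (g : {linear W -> W'}) (g' : {linear W' -> W''}) z :
  tmap f' g' (tmap f g z) = tmap (f' \o f) (g' \o g) z.
Proof.
elim/tensor_ind: z => [|x y|v w]; first by rewrite !linear0.
  by rewrite !linearD => -> ->.
by rewrite !tmapE.
Qed.

Lemma eq_tmap (V V' W W' : lmodType k) (f f' : {linear V -> V'})
  (g g' : {linear W -> W'}) : f =1 f' -> g =1 g' -> tmap f g =1 tmap f' g'.
Proof. by move=> ff' gg'; apply: tensor_ext => v w; rewrite !tmapE ff' gg'. Qed.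

Lemma tmap_id (V W : lmodType k) (f : {linear V -> V}) (g : {linear W -> W}) :
  f =1 id -> g =1 id -> tmap f g =1 id.
Proof.
move=> f1 g1; elim/tensor_ind => [|x y|v w]; first by rewrite !linear0.
  by rewrite !linearD => -> ->.
by rewrite !tmapE f1 g1.
Qed.

Lemma tassoc_tmap (V V' W W' X X' : lmodType k) (f : {linear V -> V'})
  (g : {linear W -> W'}) (h : {linear X -> X'}) z :
  tassoc V' W' X' (tmap (tmap f g) h z) = tmap f (tmap g h) (tassoc V W X z).
Proof.
elim/tensor_ind: z => [|x y Ex Ey|z x]; first by rewrite !linear0.
  by rewrite 2!linearD Ex Ey 2!linearD.
elim/tensor_ind: z => [|y z Ey Ez|v w].
- by rewrite linear0l !linear0.
- by rewrite linearDl 2!linearD Ey Ez 2!linearD.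
by rewrite tmapE (tmapE f g) 2!tassocE (tmapE f (tmap g h)) (tmapE g h).
Qed.

End MoreTensor.

Section LinearAlgebra.
Variables (k : fieldType) (V W : lmodType k).

Lemma linear_retraction (j : {linear V -> W}) :
  injective j -> exists r : {linear W -> V}, cancel j r.
Proof.
move=> j_inj.
pose P (A : set W) := (forall a u v, A u -> A v -> A (a *: u + v)) /\
  (forall v, A (j v) -> v = 0).
have [A [[A_lin A_disj] A_max]] : exists A, P A /\ forall B, A `<` B -> ~ P B.
  apply: Zorn_bigcup => F FP F_tot; split=> [a u v [A FA Au] [B FB Bv]|v [A FA]].
    have [AB|BA] := F_tot A B FA FB.
      by exists B => //; apply: (FP _ FB).1 => //; apply: AB.
    by exists A => //; apply: (FP _ FA).1 => //; apply: BA.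
  exact: (FP _ FA).2.
have A0 : A 0.
  apply: contrapT => nA0; apply: (A_max (A `|` [set 0])).
    by split=> [x Ax|/(_ 0)]; [left|move=> A0; apply/nA0/A0; right].
  have noA u : ~ A u by move=> Au; apply: nA0; rewrite -(addNr u) -scaleN1r; apply: A_lin.
  split=> [a u v [/noA//|->] [/noA//|->]|v [/noA//|jv0]].
    by right; rewrite scaler0 addr0.
  by apply: j_inj; rewrite jv0 linear0.
have dec w : exists v, A (w - j v).
  apply: contrapT => /forallNP nA.
  pose B := [set x | exists a u, A u /\ x = a *: w + u].
  apply: (A_max B).
    split=> [u Au|/(_ w) Aw]; first by exists 0, u; rewrite scale0r add0r.
    apply: (nA 0); rewrite linear0 subr0; apply: Aw; exists 1, 0.
    by rewrite scale1r addr0.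
  split=> [a _ _ [b [u [Au ->]]] [c [v [Av ->]]]|v [a [u [Au jvE]]]].
    exists (a * b + c), (a *: u + v); split; first exact: A_lin.
    by rewrite scalerDr scalerA scalerDl addrACA.
  have [a0|a0] := eqVneq a 0.
    by apply: A_disj; rewrite jvE a0 scale0r add0r.
  exfalso; apply: (nA (a^-1 *: v)); rewrite linearZ /= jvE scalerDr scalerA mulVf //.
  rewrite scale1r opprD addrA subrr add0r -scaleNr -[X in A X]addr0.
  exact: A_lin.
have uniq w v v' : A (w - j v) -> A (w - j v') -> v = v'.
  move=> Av Av'; apply/eqP; rewrite -subr_eq0; apply/eqP/A_disj.
  have := A_lin (-1) _ _ Av Av'.
  by rewrite scaleN1r opprB addrA subrK linearB.
pose r w := projT1 (cid (dec w)).
have rP w : A (w - j (r w)) by rewrite /r; case: cid.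
have r_linear : linear r.
  move=> a u v; apply: (uniq (a *: u + v)) => //.
  rewrite linearP opprD addrACA -scalerBr; exact: A_lin.
exists (mkLinear r_linear) => v; rewrite mkLinearE; apply: (uniq (j v)) => //.
by rewrite subrr.
Qed.

Lemma tmap_injl (X : lmodType k) (j : {linear V -> W}) :
  injective j -> injective (tmap j (idfun : {linear X -> X})).
Proof.
case/linear_retraction => r jK; apply: (can_inj (g := tmap r idfun)) => z.
by rewrite tmap_comp; apply: tmap_id => // v /=; apply: jK.
Qed.

(* The factorization of f through an injective map j whose image contains that
   of f. *)
Variables (X : lmodType k) (j : {linear V -> W}) (f : {linear X -> W}).
Hypotheses (j_inj : injective j) (fj : forall x, exists v, j v = f x).

Let factor_fun x := projT1 (cid (fj x)).
Let factor_funE x : j (factor_fun x) = f x.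
Proof. by rewrite /factor_fun; case: cid. Qed.
Let factor_linear : linear factor_fun.
Proof. by move=> a u v; apply: j_inj; rewrite linearP !factor_funE linearP. Qed.

Definition factor : {linear X -> V} := mkLinear factor_linear.

Lemma factorE x : j (factor x) = f x.
Proof. by rewrite /factor mkLinearE factor_funE. Qed.

End LinearAlgebra.

(* Modules over a k-algebra A are k-vector spaces with a bilinear action; an
   [lmodType A] would lose the k-structure needed for tensor products over k. *)
Record leftModule (k : fieldType) (A : algType k) := LeftModule {
  lmod_sort :> lmodType k;
  lact : {bilinear A -> lmod_sort -> lmod_sort};
  lact1 : forall m, lact 1 m = m;
  lactM : forall a b m, lact (a * b) m = lact a (lact b m)
}.

Record rightModule (k : fieldType) (A : algType k) := RightModule {
  rmod_sort :> lmodType k;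
  ract : {bilinear rmod_sort -> A -> rmod_sort};
  ract1 : forall m, ract m 1 = m;
  ractM : forall m a b, ract m (a * b) = ract (ract m a) b
}.

Record leftModuleHom (k : fieldType) (A : algType k) (M N : leftModule A) :=
  LeftModuleHom {
    lhom_fun :> {linear M -> N};
    lhomP : forall a m, lhom_fun (lact M a m) = lact N a (lhom_fun m)
  }.

Record rightModuleHom (k : fieldType) (A : algType k) (M N : rightModule A) :=
  RightModuleHom {
    rhom_fun :> {linear M -> N};
    rhomP : forall m a, rhom_fun (ract M m a) = ract N (rhom_fun m) a
  }.

Section BalancedTensor.
Variables (k : fieldType) (A : algType k).

Section Def.
Variables (M : rightModule A) (N : leftModule A).

Inductive balance_rel : M ⊗ N -> Prop :=
  BalanceRel m a n : balance_rel (ract M m a \ot n - m \ot lact N a n).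

Definition btensor := lquot balance_rel.
HB.instance Definition _ := GRing.Lmodule.on btensor.

Let btens_linl n : linear (fun m => lpi balance_rel (m \ot n)).
Proof. by move=> a u v; rewrite linearPl linearP. Qed.
Let btens_linr m : linear (fun n => lpi balance_rel (m \ot n)).
Proof. by move=> a u v; rewrite linearPr linearP. Qed.

Definition btens : {bilinear M -> N -> btensor} :=
  mkBilinear btens_linl btens_linr.

Let btensE m n : btens m n = lpi balance_rel (m \ot n).
Proof. by rewrite /btens mkBilinearE. Qed.

Lemma btens_balanced m a n : btens (ract M m a) n = btens m (lact N a n).
Proof.
apply/eqP; rewrite -subr_eq0 !btensE -linearB lpi_eq0.
exact/mem_span/BalanceRel.
Qed.

Lemma btensor_ind (Q : btensor -> Prop) : Q 0 ->
  (forall x y, Q x -> Q y -> Q (x + y)) -> (forall m n, Q (btens m n)) ->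
  forall x, Q x.
Proof.
move=> Q0 QD Qt; elim/lquotW; elim/tensor_ind => [|x y|m n].
- by rewrite linear0.
- by rewrite linearD; apply: QD.
by rewrite -btensE.
Qed.

Variables (X : lmodType k) (f : {bilinear M -> N -> X}).
Hypothesis f_balanced : forall m a n, f (ract M m a) n = f m (lact N a n).

Let blift_rel z : balance_rel z -> tlift f z = 0.
Proof. by case=> m a n; rewrite linearB !tliftE f_balanced subrr. Qed.

Definition blift : {linear btensor -> X} := qlift blift_rel.

Lemma bliftE m n : blift (btens m n) = f m n.
Proof. by rewrite btensE [LHS]qliftE tliftE. Qed.

End Def.

Section Map.
Variables (M M' : rightModule A) (N N' : leftModule A).
Variables (f : rightModuleHom M M') (g : leftModuleHom N N').

Let bmap_linl n : linear (fun m => btens M' N' (f m) (g n)).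
Proof. by move=> a u v; rewrite linearP linearPl. Qed.
Let bmap_linr m : linear (fun n => btens M' N' (f m) (g n)).
Proof. by move=> a u v; rewrite linearP linearPr. Qed.
Let bmap_balanced m a n : mkBilinear bmap_linl bmap_linr (ract M m a) n =
  mkBilinear bmap_linl bmap_linr m (lact N a n).
Proof. by rewrite mkBilinearE rhomP lhomP btens_balanced. Qed.

Definition bmap : {linear btensor M N -> btensor M' N'} := blift bmap_balanced.

Lemma bmapE m n : bmap (btens M N m n) = btens M' N' (f m) (g n).
Proof. by rewrite [LHS]bliftE mkBilinearE. Qed.

End Map.

Definition lhom_id (N : leftModule A) : leftModuleHom N N :=
  @LeftModuleHom k A N N idfun (fun a m => erefl).
Definition rhom_id (M : rightModule A) : rightModuleHom M M :=
  @RightModuleHom k A M M idfun (fun m a => erefl).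

Definition exact_at (X Y Z : lmodType k) (f : X -> Y) (g : Y -> Z) : Prop :=
  forall y, g y = 0 <-> exists x, f x = y.

(* A left module N is faithfully flat if - ⊗_A N preserves and reflects
   exact sequences, and similarly for right modules. *)
Definition faithfully_flat_left (N : leftModule A) : Prop :=
  forall (M1 M2 M3 : rightModule A)
    (f : rightModuleHom M1 M2) (g : rightModuleHom M2 M3),
    exact_at f g <-> exact_at (bmap f (lhom_id N)) (bmap g (lhom_id N)).

Definition faithfully_flat_right (M : rightModule A) : Prop :=
  forall (N1 N2 N3 : leftModule A)
    (f : leftModuleHom N1 N2) (g : leftModuleHom N2 N3),
    exact_at f g <-> exact_at (bmap (rhom_id M) f) (bmap (rhom_id M) g).

End BalancedTensor.

#[global] Opaque btensor btens blift bmap.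

(* The subspace P ⊗ Q of V ⊗ W spanned by the p \ot q with p in P and q in Q. *)
Definition tspan (k : fieldType) (V W : lmodType k) (P : set V) (Q : set W) :
  {pred V ⊗ W} := span [set p \ot q | p in P & q in Q].

Record rightCoidealSubalgebra (k : fieldType) (U : hopfAlgType k) := RightCoidealSubalgebra {
  rcs_pred :> {pred U};
  rcs_subalg : GRing.subalg_closed rcs_pred;
  rcs_coideal : forall h, h \in rcs_pred ->
    comul h \in tspan [set` rcs_pred] [set: U]
}.

(* A C-bicomodule with a coderivation, as data; the axioms are in [is_focc]. *)
Record foccData (k : fieldType) (C : coalgType k) := FoccData {
  focc_sort :> lmodType k;
  lcoact : {linear focc_sort -> C ⊗ focc_sort};
  rcoact : {linear focc_sort -> focc_sort ⊗ C};
  codiff : {linear focc_sort -> C}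
}.

Section FOCC.
Variables (k : fieldType) (C : coalgType k) (W : foccData C).

Definition is_left_comodule : Prop :=
  (forall w, tassoc C C W (tmap comul idfun (lcoact W w)) =
             tmap idfun (lcoact W) (lcoact W w)) /\
  (forall w, contractl W counit (lcoact W w) = w).

Definition is_right_comodule : Prop :=
  (forall w, tassoc W C C (tmap (rcoact W) idfun (rcoact W w)) =
             tmap idfun comul (rcoact W w)) /\
  (forall w, contractr W counit (rcoact W w) = w).

Definition is_bicomodule : Prop :=
  [/\ is_left_comodule, is_right_comodule &
      forall w, tassoc C W C (tmap (lcoact W) idfun (rcoact W w)) =
                tmap idfun (rcoact W) (lcoact W w)].

Definition is_coderivation : Prop := forall w,
  comul (codiff W w) = tmap (codiff W) idfun (rcoact W w) +
                       tmap idfun (codiff W) (lcoact W w).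

Definition is_focc : Prop :=
  [/\ is_bicomodule, is_coderivation &
      injective (fun w => tmap (idfun : {linear C -> C}) (codiff W) (lcoact W w))].

End FOCC.

Section Quotient.
Variables (k : fieldType) (U : hopfAlgType k) (H : rightCoidealSubalgebra U).

HB.instance Definition _ :=
  GRing.isSubalgClosed.Build k U (rcs_pred H) (rcs_subalg H).

Definition rcs_sub := {x : U | x \in rcs_pred H}.
HB.instance Definition _ := SubChoice.on rcs_sub.
HB.instance Definition _ := [SubChoice_isSubAlgebra of rcs_sub by <:].

Let val_mulr_linl (h : rcs_sub) : linear (fun u : U => u * val h).
Proof. by move=> a u v; rewrite mulrDl scalerAl. Qed.
Let val_mulr_linr (u : U) : linear (fun h : rcs_sub => u * val h).
Proof. by move=> a h h'; rewrite linearP mulrDr scalerAr. Qed.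
Let U_ract := mkBilinear val_mulr_linl val_mulr_linr.
Let U_ract1 u : U_ract u 1 = u.
Proof. by rewrite mkBilinearE rmorph1 mulr1. Qed.
Let U_ractM u g h : U_ract u (g * h) = U_ract (U_ract u g) h.
Proof. by rewrite !mkBilinearE rmorphM mulrA. Qed.

Let val_mull_linl (u : U) : linear (fun h : rcs_sub => val h * u).
Proof. by move=> a h h'; rewrite linearP mulrDl scalerAl. Qed.
Let val_mull_linr (h : rcs_sub) : linear (fun u : U => val h * u).
Proof. by move=> a u v; rewrite mulrDr scalerAr. Qed.
Let U_lact := mkBilinear val_mull_linl val_mull_linr.
Let U_lact1 u : U_lact 1 u = u.
Proof. by rewrite mkBilinearE rmorph1 mul1r. Qed.
Let U_lactM g h u : U_lact (g * h) u = U_lact g (U_lact h u).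
Proof. by rewrite !mkBilinearE rmorphM mulrA. Qed.

(* U as a right, respectively left, H-module by multiplication. *)
Definition Uright : rightModule rcs_sub := RightModule U_ract1 U_ractM.
Definition Uleft : leftModule rcs_sub := LeftModule U_lact1 U_lactM.

Lemma UrightE u h : ract Uright u h = u * val h.
Proof. by rewrite /= mkBilinearE. Qed.

Lemma UleftE h u : lact Uleft h u = val h * u.
Proof. by rewrite /= mkBilinearE. Qed.

Inductive UHplus : U -> Prop :=
  UHplusMul u h : h \in rcs_pred H -> counit h = 0 -> UHplus (u * h).

(* The coalgebra C = U / U H^+; [cls u] is the class [u]. *)
Definition quotC := lquot UHplus.
HB.instance Definition _ := GRing.Lmodule.on quotC.

Definition cls : {linear U -> quotC} := lpi UHplus.

Lemma clsW (Q : quotC -> Prop) : (forall u, Q (cls u)) -> forall c, Q c.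
Proof. exact: lquotW. Qed.

Lemma clsM u h : h \in rcs_pred H -> cls (u * h) = counit h *: cls u.
Proof.
move=> Hh; apply/eqP; rewrite -subr_eq0 -linearZ_LR -linearB lpi_eq0.
have -> : u * h - counit h *: u = u * (h - (counit h)%:A).
  by rewrite mulrBr -scalerAr mulr1.
apply/mem_span/UHplusMul; last first.
  by rewrite linearB linearZ_LR counit1 /= mulr1 subrr.
by rewrite rpredB // rpredZ // rpred1.
Qed.

Lemma rcs_counit_id h : h \in rcs_pred H ->
  forall (X : lmodType k) (f : {linear U -> X}) z,
  tmap cls f (tmap2 (bmul U) (bmul U) z (comul h)) =
  tmap cls f (tmap2 (bmul U) (bmul U) z (1 \ot h)).
Proof.
move=> Hh X f z; rewrite -[in RHS](counitl h).
elim/tensor_ind: z => [|x y|x y]; first by rewrite !linear0l !linear0.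
  by rewrite !linearDl !linearD => -> ->.
apply: (span_ind_linear (Q := fun w =>
  tmap cls f (tmap2 (bmul U) (bmul U) (x \ot y) w) =
  tmap cls f (tmap2 (bmul U) (bmul U) (x \ot y) (1 \ot contractl U counit w))))
  (rcs_coideal Hh); first by rewrite !(linear0, linear0r).
  move=> a u v IHu IHv; rewrite linearPr linearP IHu IHv.
  by rewrite (linearP (contractl _ _)) !(linearPr, linearP).
move=> _ [p /= Hp [q _ <-]]; rewrite contractlE !tmap2E !tmapE !bmulE.
by rewrite clsM // mulr1 -scalerAr linearZ_LR linearZl_LR linearZr_LR.
Qed.

Let comul_cls u : UHplus u -> (tmap cls cls \o comul) u = 0.
Proof.
case=> {}u h Hh h0 /=; rewrite comulM rcs_counit_id //.
elim/tensor_ind: (comul u) => [|x y|x y]; first by rewrite linear0l linear0.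
  by rewrite linearDl linearD => -> ->; rewrite addr0.
by rewrite tmap2E tmapE !bmulE mulr1 clsM // h0 scale0r linear0r.
Qed.

Let counit_cls u : UHplus u -> counit u = 0 :> k^o.
Proof. by case=> {}u h _ h0; rewrite counitM h0 mulr0. Qed.

Definition quotC_comul : {linear quotC -> quotC ⊗ quotC} := qlift comul_cls.

Definition quotC_counit : {scalar quotC} := qlift counit_cls.

Let quotC_comulE u : quotC_comul (cls u) = tmap cls cls (comul u).
Proof. exact: qliftE. Qed.
Let quotC_counitE u : quotC_counit (cls u) = counit u.
Proof. exact: (qliftE counit_cls u). Qed.

Opaque cls quotC quotC_comul quotC_counit.

Let quotC_comulA c :
  tassoc quotC quotC quotC (tmap quotC_comul idfun (quotC_comul c)) =
  tmap idfun quotC_comul (quotC_comul c).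
Proof.
elim/clsW: c => u; rewrite quotC_comulE.
rewrite (tmap_comp cls quotC_comul cls idfun).
rewrite (tmap_comp cls idfun cls quotC_comul).
rewrite (@eq_tmap _ _ _ _ _ _ (tmap cls cls \o comul) _ (cls \o idfun)) //.
rewrite (@eq_tmap _ _ _ _ _ _ (cls \o idfun) _ (tmap cls cls \o comul)) //.
rewrite -(tmap_comp comul (tmap cls cls) idfun cls).
rewrite -(tmap_comp idfun cls comul (tmap cls cls)) -comulA.
exact: tassoc_tmap.
Qed.

Let quotC_counitl c : contractl quotC quotC_counit (quotC_comul c) = c.
Proof.
elim/clsW: c => u; rewrite quotC_comulE -[in RHS](counitl u).
elim/tensor_ind: (comul u) => [|x y|x y]; first by rewrite !linear0.
  by rewrite !linearD => -> ->.
by rewrite tmapE !contractlE quotC_counitE linearZ_LR.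
Qed.

Let quotC_counitr c : contractr quotC quotC_counit (quotC_comul c) = c.
Proof.
elim/clsW: c => u; rewrite quotC_comulE -[in RHS](counitr u).
elim/tensor_ind: (comul u) => [|x y|x y]; first by rewrite !linear0.
  by rewrite !linearD => -> ->.
by rewrite tmapE !contractrE quotC_counitE linearZ_LR.
Qed.

HB.instance Definition _ := isCoalgebra.Build k quotC
  quotC_comulA quotC_counitl quotC_counitr.

Lemma comul_clsE u : comul (cls u) = tmap cls cls (comul u).
Proof. exact: quotC_comulE. Qed.

Lemma counit_clsE u : counit (cls u) = counit u.
Proof. exact: quotC_counitE. Qed.

Transparent cls quotC.

Let act_cls x u : UHplus u -> (cls \o bmul U x) u = 0.
Proof.
case=> {}u h Hh h0 /=; rewrite bmulE mulrA; apply/eqP; rewrite lpi_eq0.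
exact/mem_span/UHplusMul.
Qed.
Let act_fun (x : U) (c : quotC) : quotC := qlift (@act_cls x) c.
Let act_funE x u : act_fun x (cls u) = cls (x * u).
Proof. by rewrite /act_fun [LHS]qliftE /= bmulE. Qed.
Let act_linl (c : quotC) : linear (act_fun^~ c).
Proof.
move=> a x y; elim/clsW: c => u.
by rewrite !act_funE mulrDl -scalerAl linearP.
Qed.
Let act_linr x : linear (act_fun x).
Proof. by move=> a c d; rewrite /act_fun linearP. Qed.
Let act : {bilinear U -> quotC -> quotC} := mkBilinear act_linl act_linr.
Let act1 (c : quotC) : act 1 c = c.
Proof. by elim/clsW: c => u; rewrite mkBilinearE act_funE mul1r. Qed.
Let actM (x y : U) (c : quotC) : act (x * y) c = act x (act y c).
Proof. by elim/clsW: c => u; rewrite !mkBilinearE !act_funE mulrA. Qed.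

(* C as a left U-module, x[y] = [xy]. *)
Definition quotCmod : leftModule U := LeftModule act1 actM.

Lemma quotCmodE x u : lact quotCmod x (cls u) = cls (x * u).
Proof. by rewrite /= mkBilinearE act_funE. Qed.

Opaque cls quotC.

Lemma comul_lact (x : U) (c : quotC) :
  comul (lact quotCmod x c : quotC) = tmap2 (lact quotCmod) (lact quotCmod) (comul x) (comul c).
Proof.
elim/clsW: c => u; rewrite quotCmodE !comul_clsE comulM.
elim/tensor_ind: (comul x) => [|v w|v w]; first by rewrite !linear0l linear0.
  by rewrite !linearDl linearD => -> ->.
elim/tensor_ind: (comul u) => [|y z|y z]; first by rewrite !(linear0, linear0r).
  by rewrite !(linearDr, linearD) => -> ->.
by rewrite tmap2E !tmapE tmap2E !quotCmodE !bmulE.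
Qed.

Lemma counit_lact (x : U) (c : quotC) :
  counit (lact quotCmod x c : quotC) = counit x * counit c.
Proof. by elim/clsW: c => u; rewrite quotCmodE !counit_clsE counitM. Qed.

Lemma comul_rcs h : h \in rcs_pred H -> exists w : rcs_sub ⊗ U,
  tmap (val : {linear rcs_sub -> U}) idfun w = comul h.
Proof.
move/rcs_coideal; apply: (span_ind_linear (Q := fun z => exists w : rcs_sub ⊗ U,
  tmap (val : {linear rcs_sub -> U}) idfun w = z)); first by exists 0; rewrite linear0.
  by move=> a _ _ [v <-] [w <-]; exists (a *: v + w); rewrite linearP.
by move=> _ [p /= Hp [q _ <-]]; exists ((Sub p Hp : rcs_sub) \ot q); rewrite tmapE.
Qed.

Let qplus_linear : linear (fun c : quotC => c - counit c *: cls 1).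
Proof.
move=> a c d; rewrite linearP /= scalerDl -scalerA opprD addrACA scalerBr.
by [].
Qed.

(* c^+ = c - ε(c)[1] *)
Definition qplus : {linear quotC -> quotC} := mkLinear qplus_linear.

Lemma qplusE c : qplus c = c - counit c *: cls 1.
Proof. by rewrite /qplus mkLinearE. Qed.

Lemma qplus_cls1 : qplus (cls 1) = 0.
Proof. by rewrite qplusE counit_clsE counit1 scale1r subrr. Qed.

Lemma qplus_lact h c : h \in rcs_pred H ->
  qplus (lact quotCmod h c) = lact quotCmod h (qplus c).
Proof.
move=> Hh; rewrite !qplusE counit_lact linearBr linearZr_LR; congr (_ - _).
by rewrite quotCmodE mulr1 -[h in RHS]mul1r clsM // scalerA mulrC.
Qed.

Record quantumTangentSpace := QuantumTangentSpace {
  qts_pred :> {pred quotC};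
  qts_submod : GRing.submod_closed qts_pred;
  qts_counit : forall t, t \in qts_pred -> counit t = 0;
  qts_comul : forall t, t \in qts_pred ->
    comul t \in tspan [set s + a *: cls 1 | s in [set` qts_pred] & a in [set: k]]
                      [set: quotC];
  qts_stable : forall h t, h \in rcs_pred H -> t \in qts_pred ->
    lact quotCmod h t \in qts_pred
}.

Section TangentSpace.
Variable T : quantumTangentSpace.

HB.instance Definition _ :=
  GRing.isSubmodClosed.Build k quotC (qts_pred T) (qts_submod T).

Definition qts_sub := {c : quotC | c \in qts_pred T}.
HB.instance Definition _ := SubChoice.on qts_sub.
HB.instance Definition _ := [SubChoice_isSubLmodule of qts_sub by <:].

Definition qts_val : {linear qts_sub -> quotC} := val.

Let qts_act_fun (h : rcs_sub) (t : qts_sub) : qts_sub :=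
  Sub (lact quotCmod (val h) (val t)) (qts_stable (valP h) (valP t)).
Let qts_act_funE h t :
  qts_val (qts_act_fun h t) = lact quotCmod (val h) (qts_val t).
Proof. exact: SubK. Qed.
Let qts_act_linl t : linear (qts_act_fun^~ t).
Proof.
move=> a g h; apply: val_inj; rewrite -![val _]/(qts_val _).
by rewrite linearP !qts_act_funE linearP linearPl.
Qed.
Let qts_act_linr h : linear (qts_act_fun h).
Proof.
move=> a s t; apply: val_inj; rewrite -![val _]/(qts_val _).
by rewrite linearP !qts_act_funE !linearP.
Qed.
Let qts_act := mkBilinear qts_act_linl qts_act_linr.
Let qts_actE h t :
  qts_val (qts_act h t) = lact quotCmod (val h) (qts_val t).
Proof. by rewrite /qts_act mkBilinearE qts_act_funE. Qed.
Let qts_act1 t : qts_act 1 t = t.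
Proof.
apply: val_inj; rewrite -![val _]/(qts_val _) qts_actE rmorph1.
exact: (@lact1 _ _ quotCmod).
Qed.
Let qts_actM g h t : qts_act (g * h) t = qts_act g (qts_act h t).
Proof.
apply: val_inj; rewrite -![val _]/(qts_val _) !qts_actE rmorphM.
exact: (@lactM _ _ quotCmod).
Qed.

Definition qts_mod : leftModule rcs_sub := LeftModule qts_act1 qts_actM.

Lemma qts_modE h t :
  qts_val (lact qts_mod h t) = lact quotCmod (val h) (qts_val t).
Proof. exact: qts_actE. Qed.

Lemma qts_val_inj : injective qts_val.
Proof. exact: val_inj. Qed.

Let val_id : {linear qts_sub ⊗ quotC -> quotC ⊗ quotC} := tmap qts_val idfun.
Let plus_comul : {linear qts_sub -> quotC ⊗ quotC} :=
  tmap qplus idfun \o (comul \o qts_val).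
Let val_id_inj : injective val_id.
Proof. exact/tmap_injl/qts_val_inj. Qed.
Let qts_coact_ex t : exists s, val_id s = plus_comul t.
Proof.
rewrite /val_id /plus_comul.
apply: (span_ind_linear (Q := fun z => exists s, tmap qts_val idfun s =
  tmap qplus idfun z)) (qts_comul (valP t)).
- by exists 0; rewrite !linear0.
- by move=> a u v [x Ex] [y Ey]; exists (a *: x + y); rewrite !linearP Ex Ey.
move=> _ [_ /= [s Ts [a _ <-]] [c _ <-]].
exists ((Sub s Ts : qts_sub) \ot c); rewrite !tmapE; congr (_ \ot _).
rewrite linearD linearZ_LR qplus_cls1 scaler0 addr0 qplusE.
by rewrite (qts_counit Ts) scale0r subr0.
Qed.

(* The right coaction t |-> t_(1)^+ ⊗ t_(2), with values in T ⊗ C. *)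
Definition qts_coact : {linear qts_sub -> qts_sub ⊗ quotC} :=
  factor val_id_inj qts_coact_ex.

Lemma qts_coactE t :
  tmap qts_val idfun (qts_coact t) = tmap qplus idfun (comul (qts_val t)).
Proof. exact: (factorE val_id_inj qts_coact_ex). Qed.

Lemma qts_coact_lact (h : rcs_sub) w t :
  tmap (val : {linear rcs_sub -> U}) idfun w = comul (val h) ->
  qts_coact (lact qts_mod h t) =
  tmap2 (lact qts_mod) (lact quotCmod) w (qts_coact t).
Proof.
move=> wE; apply: (tmap_injl qts_val_inj); rewrite qts_coactE qts_modE comul_lact.
transitivity (tmap2 (lact quotCmod) (lact quotCmod) (comul (val h))
  (tmap qts_val idfun (qts_coact t))).
  rewrite qts_coactE -wE.
  elim/tensor_ind: w {wE} => [|x y Ex Ey|g u]; first by rewrite linear0 !linear0l linear0.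
    by rewrite linearD !linearDl linearD Ex Ey.
  rewrite tmapE.
  elim/tensor_ind: (comul _) => [|x y Ex Ey|c d]; first by rewrite !(linear0, linear0r).
    by rewrite !(linearDr, linearD) Ex Ey.
  by rewrite tmapE 2!tmap2E tmapE qplus_lact ?(valP g).
rewrite -wE.
elim/tensor_ind: w {wE} => [|x y Ex Ey|g u]; first by rewrite linear0 !linear0l linear0.
  by rewrite linearD !linearDl linearD Ex Ey.
rewrite tmapE.
elim/tensor_ind: (qts_coact t) => [|x y Ex Ey|c d]; first by rewrite !(linear0, linear0r).
  by rewrite !(linearDr, linearD) Ex Ey.
by rewrite tmapE 2!tmap2E tmapE qts_modE.
Qed.

(* W1 T = U ⊗_H T, with elementary tensors [w1 x t]. *)
Definition W1 := btensor Uright qts_mod.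
HB.instance Definition _ := GRing.Lmodule.on W1.

Definition w1 : {bilinear U -> qts_sub -> W1} := btens Uright qts_mod.

Lemma w1_ind (Q : W1 -> Prop) : Q 0 ->
  (forall x y, Q x -> Q y -> Q (x + y)) -> (forall x t, Q (w1 x t)) ->
  forall w, Q w.
Proof. exact: btensor_ind. Qed.

Lemma w1_balanced x (h : rcs_sub) t : w1 (x * val h) t = w1 x (lact qts_mod h t).
Proof. by rewrite -UrightE; apply: btens_balanced. Qed.

Section Lift.
Variables (X : lmodType k) (f : {bilinear U -> qts_sub -> X}).
Hypothesis f_balanced : forall x (h : rcs_sub) t,
  f (x * val h) t = f x (lact qts_mod h t).

Let w1_lift_balanced x h t : f (ract Uright x h) t = f x (lact qts_mod h t).
Proof. by rewrite UrightE f_balanced. Qed.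

Definition w1_lift : {linear W1 -> X} :=
  @blift _ _ Uright qts_mod X f w1_lift_balanced.

Lemma w1_liftE x t : w1_lift (w1 x t) = f x t.
Proof. exact: bliftE. Qed.
End Lift.
Opaque W1 w1 w1_lift.

Let w1_act1_linl x t : linear (fun y => w1 (x * y) t).
Proof. by move=> a u v; rewrite mulrDr -scalerAr linearPl. Qed.
Let w1_act1_linr x y : linear (w1 (x * y)).
Proof. by move=> a u v; rewrite linearPr. Qed.
Let w1_act1 x := mkBilinear (w1_act1_linl x) (w1_act1_linr x).
Let w1_act1E x y t : w1_act1 x y t = w1 (x * y) t.
Proof. by rewrite /w1_act1 mkBilinearE. Qed.
Let w1_act1_balanced x y (h : rcs_sub) t :
  w1_act1 x (y * val h) t = w1_act1 x y (lact qts_mod h t).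
Proof. by rewrite 2!w1_act1E mulrA w1_balanced. Qed.
Let w1_act_fun x w := w1_lift (w1_act1_balanced x) w.
Let w1_act_funE x y t : w1_act_fun x (w1 y t) = w1 (x * y) t.
Proof. by rewrite /w1_act_fun w1_liftE w1_act1E. Qed.
Let w1_act_linl w : linear (w1_act_fun^~ w).
Proof.
move=> a x y; elim/w1_ind: w => [|v w|u t].
- by rewrite /w1_act_fun !linear0 addr0.
- by rewrite /w1_act_fun !linearD => -> ->; rewrite addrACA.
by rewrite !w1_act_funE mulrDl -scalerAl linearPl.
Qed.
Let w1_act_linr x : linear (w1_act_fun x).
Proof. by move=> a v w; rewrite /w1_act_fun linearP. Qed.

Definition w1_act : {bilinear U -> W1 -> W1} := mkBilinear w1_act_linl w1_act_linr.

Lemma w1_actE x y t : w1_act x (w1 y t) = w1 (x * y) t.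
Proof. by rewrite /w1_act mkBilinearE w1_act_funE. Qed.

Let w1_linl_linear t : linear (w1^~ t).
Proof. by move=> a x y; rewrite linearPl. Qed.
Let w1_linl t : {linear U -> W1} := mkLinear (w1_linl_linear t).
Let w1_linlE t x : w1_linl t x = w1 x t.
Proof. by rewrite /w1_linl mkLinearE. Qed.

Let lco_fun x t := tmap cls (w1_linl t) (comul x).
Let lco_linl t : linear (lco_fun^~ t).
Proof. by move=> a x y; rewrite /lco_fun !linearP. Qed.
Let lco_linr x : linear (lco_fun x).
Proof.
move=> a s t; rewrite /lco_fun; elim/tensor_ind: (comul x) => [|y z|y z].
- by rewrite !linear0 addr0.
- by rewrite !linearD => -> ->; rewrite addrACA.
by rewrite !tmapE !w1_linlE linearPr linearPr.
Qed.
Let lco := mkBilinear lco_linl lco_linr.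
Let lcoE x t : lco x t = tmap cls (w1_linl t) (comul x).
Proof. by rewrite /lco mkBilinearE. Qed.
Let lco_balanced x (h : rcs_sub) t :
  lco (x * val h) t = lco x (lact qts_mod h t).
Proof.
rewrite 2!lcoE comulM (rcs_counit_id (valP h)).
elim/tensor_ind: (comul x) => [|y z Ey Ez|y z]; first by rewrite linear0l !linear0.
  by rewrite linearDl 2!linearD Ey Ez.
by rewrite tmap2E 2!bmulE mulr1 2!tmapE 2!w1_linlE w1_balanced.
Qed.

(* x ⊗_H t |-> [x_(1)] ⊗ (x_(2) ⊗_H t) *)
Definition w1_lcoact : {linear W1 -> quotC ⊗ W1} := w1_lift lco_balanced.

Lemma w1_lcoactE x t (f : {linear U -> W1}) : (forall y, f y = w1 y t) ->
  w1_lcoact (w1 x t) = tmap cls f (comul x).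
Proof.
move=> fE; rewrite /w1_lcoact w1_liftE lcoE.
by apply: eq_tmap => // y; rewrite w1_linlE fE.
Qed.

Let rco_fun x t := tmap2 w1 (lact quotCmod) (comul x) (qts_coact t).
Let rco_linl t : linear (rco_fun^~ t).
Proof. by move=> a x y; rewrite /rco_fun linearP linearPl. Qed.
Let rco_linr x : linear (rco_fun x).
Proof. by move=> a s t; rewrite /rco_fun linearP linearPr. Qed.
Let rco := mkBilinear rco_linl rco_linr.
Let rcoE x t : rco x t = tmap2 w1 (lact quotCmod) (comul x) (qts_coact t).
Proof. by rewrite /rco mkBilinearE. Qed.
Let rco_balanced x (h : rcs_sub) t :
  rco (x * val h) t = rco x (lact qts_mod h t).
Proof.
have [w wE] := comul_rcs (valP h).
rewrite 2!rcoE comulM (qts_coact_lact _ wE) -wE.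
elim/tensor_ind: (comul x) => [|y z Ey Ez|y z]; first by rewrite !linear0l.
  by rewrite !linearDl Ey Ez.
elim/tensor_ind: w {wE} => [|v w Ev Ew|g u].
- by rewrite linear0 linear0r 2!linear0l linear0r.
- by rewrite linearD linearDr 2!linearDl linearDr Ev Ew.
rewrite tmapE tmap2E 2!bmulE.
elim/tensor_ind: (qts_coact t) => [|v w Ev Ew|s c]; first by rewrite !linear0r.
  by rewrite !linearDr Ev Ew.
by rewrite 3!tmap2E w1_balanced (@lactM _ _ quotCmod).
Qed.

(* x ⊗_H t |-> (x_(1) ⊗_H t_(0)) ⊗ x_(2) t_(1) *)
Definition w1_rcoact : {linear W1 -> W1 ⊗ quotC} := w1_lift rco_balanced.

Lemma w1_rcoactE x t : w1_rcoact (w1 x t) =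
  tmap2 w1 (lact quotCmod) (comul x) (qts_coact t).
Proof. by rewrite /w1_rcoact w1_liftE rcoE. Qed.

Let dif_fun (x : U) (t : qts_sub) : quotC := lact quotCmod x (qts_val t).
Let dif_linl t : linear (dif_fun^~ t).
Proof. by move=> a x y; rewrite /dif_fun linearPl. Qed.
Let dif_linr x : linear (dif_fun x).
Proof. by move=> a s t; rewrite /dif_fun !linearP. Qed.
Let dif := mkBilinear dif_linl dif_linr.
Let difE x t : dif x t = lact quotCmod x (qts_val t).
Proof. by rewrite /dif mkBilinearE. Qed.
Let dif_balanced x (h : rcs_sub) t :
  dif (x * val h) t = dif x (lact qts_mod h t).
Proof. by rewrite 2!difE (@lactM _ _ quotCmod) qts_modE. Qed.

(* x ⊗_H t |-> x t *)
Definition w1_codiff : {linear W1 -> quotC} := w1_lift dif_balanced.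

Lemma w1_codiffE x t : w1_codiff (w1 x t) = lact quotCmod x (qts_val t).
Proof. by rewrite /w1_codiff w1_liftE difE. Qed.

End TangentSpace.

Record equivariantFoccData := EquivariantFoccData {
  efocc_data :> foccData quotC;
  efocc_act : {bilinear U -> efocc_data -> efocc_data}
}.

Definition is_equivariant_focc (W : equivariantFoccData) : Prop :=
  is_focc W /\
  [/\ (forall w, efocc_act W 1 w = w) /\
      (forall x y w, efocc_act W (x * y) w = efocc_act W x (efocc_act W y w)),
      forall x w, lcoact W (efocc_act W x w) =
        tmap2 (lact quotCmod) (efocc_act W) (comul x) (lcoact W w),
      forall x w, rcoact W (efocc_act W x w) =
        tmap2 (efocc_act W) (lact quotCmod) (comul x) (rcoact W w) &
      forall x w, codiff W (efocc_act W x w) = lact quotCmod x (codiff W w)].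

Definition efocc_iso (W W' : equivariantFoccData) : Prop :=
  exists f : {linear W -> W'},
    [/\ bijective f,
        forall x w, f (efocc_act W x w) = efocc_act W' x (f w),
        forall w, lcoact W' (f w) = tmap idfun f (lcoact W w),
        forall w, rcoact W' (f w) = tmap f idfun (rcoact W w) &
        forall w, codiff W' (f w) = codiff W w].

Definition tangent_focc (T : quantumTangentSpace) : equivariantFoccData :=
  @EquivariantFoccData
    (FoccData (w1_lcoact T) (w1_rcoact T) (w1_codiff T)) (w1_act T).

Definition iso_class (W W' : equivariantFoccData) : Prop :=
  is_equivariant_focc W' /\ efocc_iso W W'.

Record isoClass := IsoClass {
  iso_class_mem :> equivariantFoccData -> Prop;
  iso_classP : exists2 W, is_equivariant_focc W & iso_class_mem = iso_class W
}.

End Quotient.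

#[global] Opaque cls quotC quotC_comul quotC_counit W1 w1 w1_lift.

(* Main.v *)
Require Import Defs.
From HB Require Import structures.
From mathcomp Require Import all_boot all_algebra.
From mathcomp Require Import boolp classical_sets.

(** Call a left U-module M with a U-linear left C-coaction lam, for the diagonal
    action on C ⊗ M, a relative Hopf module, and m in M coinvariant when
    lam m = [1] ⊗ m. The theorem rests on Takeuchi's correspondence between
    relative Hopf modules and left H-modules, by coinvariants in one direction
    and N |-> U ⊗_H N in the other.

    For every U-module M, the antipode makes x ⊗ m |-> [x_(1)] ⊗ x_(2) m an
    isomorphism of U ⊗_H M with C ⊗ M ([canmap_inj], [canmap_surj]). For a
    relative Hopf module, let d m = lam m - [1] ⊗ m, an H-linear map with
    kernel the coinvariants. Under the canonical isomorphisms, U ⊗_H d becomes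
    the differential C ⊗ M -> C ⊗ C ⊗ M of the cobar complex, whose kernel is
    the image of lam because of the counit ([bmap_defect_eq0]). If an injective
    i : N -> M has the coinvariants as its image, then U ⊗_H N -> U ⊗_H M is
    therefore injective, by flatness, with image corresponding to that of lam,
    so that U ⊗_H N is isomorphic to M ([extension_bij]). If instead M is
    U ⊗_H N, then faithful flatness reflects the exactness of
    U ⊗_H N -> U ⊗_H M -> U ⊗_H (C ⊗ M), so that the coinvariants of M are the
    elements 1 ⊗ n ([coinvariants_exact]).

    For a quantum tangent space T, all structure maps of U ⊗_H T are U-linear,
    and the axioms of an equivariant calculus hold because they hold on the
    generators 1 ⊗ t. The map w |-> w_(-1) ⊗ delta(w_(0)) is injective since it
    is U ⊗_H T -> U ⊗_H C, injective by flatness, followed by the canonical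
    isomorphism for M = C ([tangent_focc_equivariant]). Conversely, the
    coderivation delta of an equivariant calculus W is injective on the
    coinvariants, where w_(-1) ⊗ delta(w_(0)) = [1] ⊗ delta w; their image under
    delta is a quantum tangent space T, and W is isomorphic to U ⊗_H T as a
    calculus ([tangent_focc_coinv]). Finally T is recovered from U ⊗_H T as the
    image of the coinvariants 1 ⊗ t under delta, and isomorphisms preserve
    coinvariants and delta ([efocc_iso_tangent_sub]). *)

Set Implicit Arguments.
Unset Strict Implicit.
Unset Printing Implicit Defensive.

Import GRing.Theory.
Local Open Scope ring_scope.

(** * Tensor products and linear algebra *)

Section TensorIdentities.
Variable k : fieldType.

Section Assoc.
Variables (A B C M N P X Y Z : lmodType k).
Variables (f : {bilinear A -> M -> X}) (g : {bilinear B -> N -> Y})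
  (h : {bilinear C -> P -> Z}).

Lemma tassoc_tmap2 s z :
  tassoc X Y Z (tmap2 (tmap2 f g) h s z) =
  tmap2 f (tmap2 g h) (tassoc A B C s) (tassoc M N P z).
Proof.
elim/tensor_ind: s => [|r s Er Es|r c].
- by rewrite linear0 2!linear0l linear0.
- by rewrite linearD 2!linearDl linearD Er Es.
elim/tensor_ind: r => [|r s Er Es|a b].
- by rewrite linear0l linear0 2!linear0l linear0.
- by rewrite linearDl linearD 2!linearDl linearD Er Es.
elim/tensor_ind: z => [|r s Er Es|z p].
- by rewrite !(linear0, linear0r).
- by rewrite !(linearD, linearDr) Er Es.
elim/tensor_ind: z => [|r s Er Es|m n].
- by rewrite linear0l !(linear0, linear0r).
- by rewrite linearDl !(linearD, linearDr) Er Es.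
by rewrite !tassocE !tmap2E tassocE.
Qed.
End Assoc.

Section Natural.
Variables (A A' B B' M M' N N' X X' Y Y' : lmodType k).
Variables (f : {bilinear A -> M -> X}) (g : {bilinear B -> N -> Y}).
Variables (f' : {bilinear A' -> M' -> X'}) (g' : {bilinear B' -> N' -> Y'}).
Variables (a : {linear A -> A'}) (b : {linear B -> B'}).
Variables (m : {linear M -> M'}) (n : {linear N -> N'}).
Variables (x : {linear X -> X'}) (y : {linear Y -> Y'}).

Lemma tmap_tmap2 s z :
  (forall u v, x (f u v) = f' (a u) (m v)) ->
  (forall u v, y (g u v) = g' (b u) (n v)) ->
  tmap x y (tmap2 f g s z) = tmap2 f' g' (tmap a b s) (tmap m n z).
Proof.
move=> xf yg; elim/tensor_ind: s => [|r s Er Es|u v].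
- by rewrite linear0 2!linear0l linear0.
- by rewrite linearD 2!linearDl linearD Er Es.
elim/tensor_ind: z => [|r s Er Es|w z].
- by rewrite !(linear0, linear0r).
- by rewrite !(linearD, linearDr) Er Es.
by rewrite tmap2E !tmapE tmap2E xf yg.
Qed.
End Natural.
End TensorIdentities.

Lemma tmap_idfun (k : fieldType) (V W : lmodType k) (z : V ⊗ W) :
  tmap idfun idfun z = z.
Proof. exact: tmap_id. Qed.

Lemma tmapD (k : fieldType) (V V' W W' : lmodType k) (f : {linear V -> V'})
    (g : {linear W -> W'}) y z :
  tmap f g (y + z) = tmap f g y + tmap f g z.
Proof. exact: linearD. Qed.

Lemma contractr_tmap (k : fieldType) (V V' W W' : lmodType k)
    (f : {linear V -> V'}) (g : {linear W -> W'}) (e : {scalar W})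
    (e' : {scalar W'}) z :
  (forall w, e' (g w) = e w) ->
  contractr V' e' (tmap f g z) = f (contractr V e z).
Proof.
move=> eg; elim/tensor_ind: z => [|u v Eu Ev|v w].
- by rewrite !linear0.
- by rewrite !linearD Eu Ev.
by rewrite tmapE !contractrE eg linearZ_LR.
Qed.

Section AssocInverse.
Variables (k : fieldType) (V W X : lmodType k).

Let unassoc_fun (v : V) (z : W ⊗ X) : (V ⊗ W) ⊗ X :=
  tmap (tens V W v) idfun z.
Let unassoc_linl z : linear (unassoc_fun^~ z).
Proof.
move=> a u v; rewrite /unassoc_fun; elim/tensor_ind: z => [|y z Ey Ez|w x].
- by rewrite !linear0 addr0.
- by rewrite !linearD Ey Ez addrACA.
by rewrite !tmapE /= linearPl linearPl.
Qed.
Let unassoc_linr v : linear (unassoc_fun v).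
Proof. by move=> a y z; rewrite /unassoc_fun linearP. Qed.

Lemma tassoc_inj : injective (tassoc V W X).
Proof.
pose h := tlift (mkBilinear unassoc_linl unassoc_linr).
apply: (can_inj (g := h)); elim/tensor_ind => [|y z Ey Ez|z x].
- by rewrite !linear0.
- by rewrite !linearD Ey Ez.
elim/tensor_ind: z => [|y z Ey Ez|v w].
- by rewrite linear0l !linear0.
- by rewrite linearDl !linearD Ey Ez.
by rewrite tassocE [LHS]tliftE mkBilinearE /unassoc_fun tmapE.
Qed.
End AssocInverse.

Section LinearFactor.
Variables (k : fieldType) (V X Y : lmodType k).
Variables (f : {linear V -> X}) (s : {linear V -> Y}).
Hypothesis fs : forall v, f v = 0 -> s v = 0.

Let P : set V := fun v => f v = 0.

(** f induces an injection of V / ker f into X, and injections have linear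
    retractions. *)
Lemma linear_factor : exists g : {linear X -> Y}, forall v, g (f v) = s v.
Proof.
pose fbar := @qlift k V P X f (fun v fv => fv).
pose sbar := @qlift k V P Y s fs.
have [|r fK] := @linear_retraction k _ _ fbar; last first.
  exists (sbar \o r) => v /=.
  have -> : f v = fbar (lpi P v) by rewrite qliftE.
  by rewrite fK qliftE.
elim/lquotW => u; elim/lquotW => v; rewrite !qliftE => uv.
apply/eqP; rewrite -subr_eq0 -linearB lpi_eq0; apply: mem_span.
by rewrite /P linearB uv subrr.
Qed.
End LinearFactor.

Section Kernel.
Variables (k : fieldType) (V X : lmodType k) (f : {linear V -> X}).

Definition ker_pred : {pred V} := fun v => f v == 0.

Lemma ker_submod_closed : GRing.submod_closed ker_pred.
Proof.
split=> [|a u v]; first exact/eqP/linear0.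
move=> /eqP fu /eqP fv; apply/eqP.
by rewrite linearP fu fv scaler0 addr0.
Qed.

HB.instance Definition _ :=
  GRing.isSubmodClosed.Build k V ker_pred ker_submod_closed.

Definition ker_sub := {v : V | v \in ker_pred}.
HB.instance Definition _ := SubChoice.on ker_sub.
HB.instance Definition _ := [SubChoice_isSubLmodule of ker_sub by <:].

Definition ker_val : {linear ker_sub -> V} := val.

Lemma ker_valP w : f (ker_val w) = 0.
Proof. exact/eqP/(valP w). Qed.

Lemma ker_valK v : f v = 0 -> exists w, ker_val w = v.
Proof.
move=> fv; have Kv : v \in ker_pred by apply/eqP.
by exists (Sub v Kv); apply: (SubK ker_sub Kv).
Qed.

(** Tensoring over a field is exact. As id - p vanishes on the kernel of f,
    it factors as g ∘ f, and z - (p ⊗ id) z = (g ⊗ id) ((f ⊗ id) z). *)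
Lemma kernel_projection : exists p : {linear V -> V}, (forall v, f (p v) = 0) /\
  forall (Y : lmodType k) (z : V ⊗ Y), tmap f idfun z = 0 -> tmap p idfun z = z.
Proof.
have [r rK] := linear_retraction (val_inj : injective ker_val).
pose p : {linear V -> V} := ker_val \o r.
pose s : {linear V -> V} := idfun \- p.
have fs v : f v = 0 -> s v = 0.
  by case/ker_valK => w <-; rewrite /s /p /= rK subrr.
have [g gf] := linear_factor fs.
exists p; split=> [v|Y z fz]; first exact: ker_valP.
apply/esym/eqP; rewrite -subr_eq0; apply/eqP.
have -> : z - tmap p idfun z = tmap g idfun (tmap f idfun z).
  elim/tensor_ind: z {fz} => [|y z Ey Ez|v y].
  - by rewrite !linear0 addr0.
  - by rewrite !linearD /= -Ey -Ez addrACA.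
  by rewrite !tmapE gf /s /= linearBl.
by rewrite fz linear0.
Qed.

Lemma kernel_section (Y : lmodType k) (d : {linear V -> Y}) :
  (forall v, f v = 0 -> d v = 0 -> v = 0) ->
  exists h : {linear Y -> V}, forall v, f v = 0 -> h (d v) = v.
Proof.
move=> d_inj; have dv_inj : injective (d \o ker_val).
  move=> u v /= uv; apply/val_inj/eqP; rewrite -subr_eq0; apply/eqP.
  apply: d_inj; first by rewrite linearB !ker_valP subrr.
  by rewrite linearB; apply/eqP; rewrite subr_eq0; apply/eqP.
have [r rK] := linear_retraction dv_inj.
by exists (ker_val \o r) => v /ker_valK[w <-] /=; rewrite [r _]rK.
Qed.
End Kernel.

(** * Modules over the Hopf algebra and the diagonal action *)

Section Modules.
Variables (k : fieldType) (U : hopfAlgType k).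

Definition equivariant (M N : leftModule U) (f : M -> N) : Prop :=
  forall x m, f (lact M x m) = lact N x (f m).

Lemma equivariant_idfun (M : leftModule U) :
  equivariant (M := M) (N := M) idfun.
Proof. by []. Qed.

Section Diagonal.
Variables M N : leftModule U.

Let diag_linl z : linear (fun x : U => tmap2 (lact M) (lact N) (comul x) z).
Proof. by move=> a x y; rewrite linearP linearPl. Qed.
Let diag_linr (x : U) : linear (tmap2 (lact M) (lact N) (comul x)).
Proof. by move=> a y z; rewrite linearPr. Qed.

Definition diag_act : {bilinear U -> M ⊗ N -> M ⊗ N} :=
  mkBilinear diag_linl diag_linr.

Lemma diag_actE x z : diag_act x z = tmap2 (lact M) (lact N) (comul x) z.
Proof. by rewrite /diag_act mkBilinearE. Qed.

Lemma diag_act1 z : diag_act 1 z = z.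
Proof.
rewrite diag_actE comul1; elim/tensor_ind: z => [|y z Ey Ez|m n].
- exact: linear0r.
- by rewrite linearDr Ey Ez.
by rewrite tmap2E !lact1.
Qed.

Lemma diag_actM x y z : diag_act (x * y) z = diag_act x (diag_act y z).
Proof.
rewrite !diag_actE comulM.
elim/tensor_ind: (comul x) => [|r s Er Es|a b]; first by rewrite !linear0l.
  by rewrite !linearDl Er Es.
elim/tensor_ind: (comul y) => [|r s Er Es|c d].
- by rewrite linear0r !linear0l linear0r.
- by rewrite linearDr !linearDl linearDr Er Es.
elim/tensor_ind: z => [|r s Er Es|m n]; first by rewrite !linear0r.
  by rewrite !linearDr Er Es.
by rewrite !tmap2E !bmulE !lactM.
Qed.

Definition diag_mod : leftModule U := LeftModule diag_act1 diag_actM.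

Lemma diag_modE x z :
  lact diag_mod x z = tmap2 (lact M) (lact N) (comul x) z.
Proof. exact: diag_actE. Qed.
End Diagonal.

Lemma equivariant_tmap (M M' N N' : leftModule U) (f : {linear M -> M'})
    (g : {linear N -> N'}) :
  equivariant f -> equivariant g ->
  equivariant (M := diag_mod M N) (N := diag_mod M' N') (tmap f g).
Proof.
move=> fU gU x z; rewrite !diag_modE.
by rewrite -[in RHS](tmap_idfun (comul x)); apply: tmap_tmap2.
Qed.

Lemma equivariant_tassoc (M N P : leftModule U) :
  equivariant (M := diag_mod (diag_mod M N) P)
    (N := diag_mod M (diag_mod N P)) (tassoc M N P).
Proof.
move=> x z; rewrite !diag_modE.
transitivity (tassoc M N P (tmap2 (tmap2 (lact M) (lact N)) (lact P)
  (tmap comul idfun (comul x)) z)).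
  congr (tassoc _ _ _ _); rewrite -[LHS]tmap_idfun -[z in RHS]tmap_idfun.
  by apply: tmap_tmap2 => // u v; apply: diag_modE.
rewrite tassoc_tmap2 comulA -[RHS]tmap_idfun.
rewrite -[tassoc _ _ _ z in LHS]tmap_idfun.
by apply/esym; apply: tmap_tmap2 => // u v; apply: diag_modE.
Qed.

End Modules.
Arguments equivariant_idfun {k U} M.

(** In U ⊗_H T everything is a sum of translates of the elements 1 ⊗ t, and
    the structure maps are U-linear. The axioms of a bicomodule and of a
    coderivation equate U-linear maps, for the diagonal actions, so they
    hold as soon as they hold on the generators; the lemmas below reduce
    them one by one. *)
Section Generated.
Variables (k : fieldType) (U : hopfAlgType k) (M C : leftModule U).
Variables (G : Type) (i : G -> M).
Hypothesis M_gen : forall P : M -> Prop, P 0 ->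
  (forall m n, P m -> P n -> P (m + n)) -> (forall x g, P (lact M x (i g))) ->
  forall m, P m.

Lemma generated_ext (N : leftModule U) (f g : {linear M -> N}) :
  equivariant f -> equivariant g -> (forall a, f (i a) = g (i a)) -> f =1 g.
Proof.
move=> fU gU fg; apply: M_gen => [|m n fm fn|x a].
- by rewrite !linear0.
- by rewrite !linearD fm fn.
by rewrite fU gU fg.
Qed.

Variables (D : {linear C -> C ⊗ C}) (e : {scalar C}).
Variables (lam : {linear M -> C ⊗ M}) (rho : {linear M -> M ⊗ C}).
Variable del : {linear M -> C}.
Hypothesis DU : equivariant (N := diag_mod C C) D.
Hypothesis lamU : equivariant (N := diag_mod C M) lam.
Hypothesis rhoU : equivariant (N := diag_mod M C) rho.
Hypothesis delU : equivariant del.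

Lemma generated_lcoactA :
  (forall a, tassoc C C M (tmap D idfun (lam (i a))) =
    tmap idfun lam (lam (i a))) ->
  forall m, tassoc C C M (tmap D idfun (lam m)) = tmap idfun lam (lam m).
Proof.
pose f : {linear M -> diag_mod C (diag_mod C M)} :=
  tassoc C C M \o (tmap D idfun \o lam).
pose g : {linear M -> diag_mod C (diag_mod C M)} := tmap idfun lam \o lam.
move=> fg; suff E : f =1 g by move=> m; have := E m; rewrite /f /g /=.
apply: generated_ext => // x m; rewrite /f /g /= lamU.
  by rewrite (equivariant_tmap DU (equivariant_idfun M)) equivariant_tassoc.
by rewrite (equivariant_tmap (equivariant_idfun C) lamU).
Qed.

Lemma generated_rcoactA :
  (forall a, tassoc M C C (tmap rho idfun (rho (i a))) =
    tmap idfun D (rho (i a))) ->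
  forall m, tassoc M C C (tmap rho idfun (rho m)) = tmap idfun D (rho m).
Proof.
pose f : {linear M -> diag_mod M (diag_mod C C)} :=
  tassoc M C C \o (tmap rho idfun \o rho).
pose g : {linear M -> diag_mod M (diag_mod C C)} := tmap idfun D \o rho.
move=> fg; suff E : f =1 g by move=> m; have := E m; rewrite /f /g /=.
apply: generated_ext => // x m; rewrite /f /g /= rhoU.
  by rewrite (equivariant_tmap rhoU (equivariant_idfun C)) equivariant_tassoc.
by rewrite (equivariant_tmap (equivariant_idfun M) DU).
Qed.

Lemma generated_bicomodule :
  (forall a, tassoc C M C (tmap lam idfun (rho (i a))) =
    tmap idfun rho (lam (i a))) ->
  forall m, tassoc C M C (tmap lam idfun (rho m)) = tmap idfun rho (lam m).
Proof.
pose f : {linear M -> diag_mod C (diag_mod M C)} :=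
  tassoc C M C \o (tmap lam idfun \o rho).
pose g : {linear M -> diag_mod C (diag_mod M C)} := tmap idfun rho \o lam.
move=> fg; suff E : f =1 g by move=> m; have := E m; rewrite /f /g /=.
apply: generated_ext => // x m; rewrite /f /g /= (rhoU, lamU).
  by rewrite (equivariant_tmap lamU (equivariant_idfun C)) equivariant_tassoc.
by rewrite (equivariant_tmap (equivariant_idfun C) rhoU).
Qed.

Lemma generated_coderivation :
  (forall a, D (del (i a)) =
    tmap del idfun (rho (i a)) + tmap idfun del (lam (i a))) ->
  forall m, D (del m) = tmap del idfun (rho m) + tmap idfun del (lam m).
Proof.
pose f : {linear M -> diag_mod C C} := D \o del.
pose g1 : {linear M -> diag_mod C C} := tmap del idfun \o rho.
pose g2 : {linear M -> diag_mod C C} := tmap idfun del \o lam.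
pose g : {linear M -> diag_mod C C} := g1 \+ g2.
move=> fg; suff E : f =1 g by move=> m; have := E m; rewrite /f /g /=.
apply: generated_ext => // x m; rewrite /f /g /= ?delU ?DU //.
rewrite /g1 /g2 /= rhoU lamU (equivariant_tmap delU (equivariant_idfun C)).
by rewrite (equivariant_tmap (equivariant_idfun C) delU) linearDr.
Qed.

Lemma generated_lcounit :
  equivariant (M := diag_mod C M) (contractl M e) ->
  (forall a, contractl M e (lam (i a)) = i a) ->
  forall m, contractl M e (lam m) = m.
Proof.
move=> eU; pose f : {linear M -> M} := contractl M e \o lam.
apply: (@generated_ext _ f idfun) => x m //.
by rewrite /f /= lamU eU.
Qed.

Lemma generated_rcounit :
  equivariant (M := diag_mod M C) (contractr M e) ->
  (forall a, contractr M e (rho (i a)) = i a) ->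
  forall m, contractr M e (rho m) = m.
Proof.
move=> eU; pose f : {linear M -> M} := contractr M e \o rho.
apply: (@generated_ext _ f idfun) => x m //.
by rewrite /f /= rhoU eU.
Qed.

End Generated.

Section GeneratedColinear.
Variables (k : fieldType) (U : hopfAlgType k) (M M' C : leftModule U).
Variables (G : Type) (i : G -> M).
Hypothesis M_gen : forall P : M -> Prop, P 0 ->
  (forall m n, P m -> P n -> P (m + n)) -> (forall x g, P (lact M x (i g))) ->
  forall m, P m.
Variables (f : {linear M -> M'}).
Hypothesis fU : equivariant f.

Lemma generated_lcolinear (lam : {linear M -> C ⊗ M})
    (lam' : {linear M' -> C ⊗ M'}) :
  equivariant (N := diag_mod C M) lam ->
  equivariant (N := diag_mod C M') lam' ->
  (forall a, lam' (f (i a)) = tmap idfun f (lam (i a))) ->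
  forall m, lam' (f m) = tmap idfun f (lam m).
Proof.
move=> lamU lamU'.
pose g1 : {linear M -> diag_mod C M'} := lam' \o f.
pose g2 : {linear M -> diag_mod C M'} := tmap idfun f \o lam.
move=> gE; suff E : g1 =1 g2 by move=> m; have := E m; rewrite /g1 /g2 /=.
apply: (generated_ext M_gen) => // x m; rewrite /g1 /g2 /=.
  by rewrite fU lamU'.
by rewrite lamU (equivariant_tmap (equivariant_idfun C) fU).
Qed.

Lemma generated_rcolinear (rho : {linear M -> M ⊗ C})
    (rho' : {linear M' -> M' ⊗ C}) :
  equivariant (N := diag_mod M C) rho ->
  equivariant (N := diag_mod M' C) rho' ->
  (forall a, rho' (f (i a)) = tmap f idfun (rho (i a))) ->
  forall m, rho' (f m) = tmap f idfun (rho m).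
Proof.
move=> rhoU rhoU'.
pose g1 : {linear M -> diag_mod M' C} := rho' \o f.
pose g2 : {linear M -> diag_mod M' C} := tmap f idfun \o rho.
move=> gE; suff E : g1 =1 g2 by move=> m; have := E m; rewrite /g1 /g2 /=.
apply: (generated_ext M_gen) => // x m; rewrite /g1 /g2 /=.
  by rewrite fU rhoU'.
by rewrite rhoU (equivariant_tmap fU (equivariant_idfun C)).
Qed.
End GeneratedColinear.

(** * The twist of U ⊗ M *)

Section Twist.
Variables (k : fieldType) (U : hopfAlgType k).

Definition regular : leftModule U :=
  @LeftModule k U U (bmul U)
    (fun m => etrans (bmulE 1 m) (mul1r m))
    (fun a b m => etrans (bmulE (a * b) m)
       (etrans (esym (mulrA a b m))
         (esym (etrans (bmulE a _) (congr1 _ (bmulE b m)))))).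

Lemma regularE x y : lact regular x y = x * y.
Proof. exact: bmulE. Qed.

Variable M : leftModule U.

Let orbit_linear (m : M) : linear (fun x => lact M x m).
Proof. by move=> a x y; rewrite linearPl. Qed.

Definition orbit_map (m : M) : {linear U -> M} := mkLinear (orbit_linear m).

Lemma orbit_mapE m x : orbit_map m x = lact M x m.
Proof. by rewrite /orbit_map mkLinearE. Qed.

Variable s : {linear U -> U}.

Let twist_fun x m :=
  tmap (idfun : {linear U -> U}) (orbit_map m \o s) (comul x).
Let twist_linl m : linear (twist_fun^~ m).
Proof. by move=> a x y; rewrite /twist_fun !linearP. Qed.
Let twist_linr x : linear (twist_fun x).
Proof.
move=> a m n; rewrite /twist_fun; elim/tensor_ind: (comul x) => [|y z|y z].
- by rewrite !linear0 addr0.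
- by rewrite !linearD => -> ->; rewrite addrACA.
by rewrite !tmapE /= !orbit_mapE linearPr linearPr.
Qed.

(** x ⊗ m |-> x_(1) ⊗ s(x_(2)) m. For s the identity, this maps U ⊗ M with U
    acting on the left factor to U ⊗ M with the diagonal action. *)
Definition twist : {linear U ⊗ M -> U ⊗ M} :=
  tlift (mkBilinear twist_linl twist_linr).

Lemma twistE x m : twist (x \ot m) = tmap idfun (orbit_map m \o s) (comul x).
Proof. by rewrite [LHS]tliftE mkBilinearE. Qed.

End Twist.

Section TwistTheory.
Variables (k : fieldType) (U : hopfAlgType k) (M : leftModule U).

(** By coassociativity the composite is x ⊗ m |-> x_(1) ⊗ t(x_(2)) s(x_(3))
    m, and t is a left convolution inverse of s. *)
Lemma twistK (s t : {linear U -> U}) :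
  (forall x, tlift (bmul U) (tmap t s (comul x)) = (counit x)%:A) ->
  cancel (twist M s) (twist M t).
Proof.
move=> st; elim/tensor_ind => [|y z Ey Ez|x m].
- by rewrite !linear0.
- by rewrite !linearD Ey Ez.
rewrite twistE.
pose K : {linear U ⊗ (U ⊗ U) -> U ⊗ M} :=
  tmap idfun (orbit_map m \o (tlift (bmul U) \o tmap t s)).
have E z : twist M t (tmap idfun (orbit_map m \o s) z) =
    K (tassoc U U U (tmap comul idfun z)).
  elim/tensor_ind: z => [|y z Ey Ez|a b].
  - by rewrite !linear0.
  - by rewrite !linearD Ey Ez.
  rewrite tmapE [tmap comul _ _]tmapE twistE.
  elim/tensor_ind: (comul a) => [|y z Ey Ez|c d].
  - by rewrite linear0l !linear0.
  - by rewrite linearDl !linearD Ey Ez.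
  by rewrite tassocE !tmapE /= tmapE tliftE bmulE !orbit_mapE lactM.
rewrite E comulA /K tmap_comp -[x in RHS]counitr.
elim/tensor_ind: (comul x) => [|y z Ey Ez|a b].
- by rewrite !linear0 linear0l.
- by rewrite !linearD linearDl Ey Ez.
rewrite tmapE contractrE /= st orbit_mapE linearZl_LR lact1.
by rewrite linearZl_LR linearZr_LR.
Qed.

Lemma twist_idE x m :
  twist M idfun (x \ot m) = lact (diag_mod (regular U) M) x (1 \ot m).
Proof.
rewrite twistE diag_modE; elim/tensor_ind: (comul x) => [|y z Ey Ez|a b].
- by rewrite linear0 linear0l.
- by rewrite linearD linearDl Ey Ez.
by rewrite tmapE tmap2E regularE mulr1 /= orbit_mapE.
Qed.

Lemma twist_idK : cancel (twist M idfun) (twist M antipode).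
Proof. exact/twistK/antipodel. Qed.

Lemma twist_antipodeK : cancel (twist M antipode) (twist M idfun).
Proof. exact/twistK/antipoder. Qed.

(** The inverse of a U-linear map is U-linear. This stands in for the
    anti-multiplicativity of the antipode. *)
Lemma twist_antipode_act x z :
  twist M antipode (lact (diag_mod (regular U) M) x z) =
  tmap (bmul U x) idfun (twist M antipode z).
Proof.
rewrite -{1}(twist_antipodeK z); set y := twist M antipode z.
elim/tensor_ind: y => [|y z' Ey Ez|a m].
- by rewrite !linear0.
- by rewrite !linearD Ey Ez.
by rewrite twist_idE -lactM -twist_idE twist_idK tmapE /= bmulE.
Qed.

End TwistTheory.

(** * The canonical isomorphism of U ⊗_H M with C ⊗ M *)

Section Canonical.
Variables (k : fieldType) (U : hopfAlgType k) (H : rightCoidealSubalgebra U).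

Notation C := (quotCmod H).
Notation one := (cls H 1).
Notation inH := (val : {linear rcs_sub H -> U}).

Section Restriction.
Variable M : leftModule U.

Let restr_linl m : linear (fun h : rcs_sub H => lact M (val h) m).
Proof. by move=> a g h; rewrite linearP linearPl. Qed.
Let restr_linr (h : rcs_sub H) : linear (lact M (val h)).
Proof. by move=> a m n; rewrite linearPr. Qed.
Let restr_act := mkBilinear restr_linl restr_linr.
Let restr_actE h m : restr_act h m = lact M (val h) m.
Proof. by rewrite /restr_act mkBilinearE. Qed.
Let restr_act1 m : restr_act 1 m = m.
Proof. by rewrite restr_actE rmorph1 lact1. Qed.
Let restr_actM g h m : restr_act (g * h) m = restr_act g (restr_act h m).
Proof. by rewrite !restr_actE rmorphM lactM. Qed.

Definition restr : leftModule (rcs_sub H) := LeftModule restr_act1 restr_actM.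

Lemma restrE h m : lact restr h m = lact M (val h) m.
Proof. exact: restr_actE. Qed.
End Restriction.

Section OneModule.
Variable M : leftModule U.

(** As H is a right coideal, h_(1) lies in H, which acts on [1] by the
    counit. *)
Lemma diag_mod_one (h : rcs_sub H) (m : M) :
  lact (diag_mod C M) (val h) (one \ot m) = one \ot lact M (val h) m.
Proof.
have [w wE] := comul_rcs (valP h).
suff E : tmap2 (lact C) (lact M) (tmap inH idfun w) (one \ot m) =
    one \ot lact M (contractl U counit (tmap inH idfun w)) m.
  by rewrite diag_modE -wE E wE counitl.
elim/tensor_ind: w {wE} => [|y z Ey Ez|g u].
- by rewrite !linear0 !linear0l linear0r.
- by rewrite !linearD !linearDl linearDr Ey Ez.
rewrite tmapE tmap2E quotCmodE mulr1 -[inH g]mul1r clsM ?(valP g) //.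
by rewrite contractlE mul1r linearZl_LR linearZl_LR linearZr_LR.
Qed.

Let can_fun x (m : M) := lact (diag_mod C M) x (one \ot m).
Let can_linl m : linear (can_fun^~ m).
Proof. by move=> a x y; rewrite /can_fun linearPl. Qed.
Let can_linr x : linear (can_fun x).
Proof. by move=> a m n; rewrite /can_fun !linearPr. Qed.
Let can_bil : {bilinear U -> M -> _} := mkBilinear can_linl can_linr.
Let can_balanced x (h : rcs_sub H) (m : M) :
  can_bil (ract (Uright H) x h) m = can_bil x (lact (restr M) h m).
Proof.
by rewrite UrightE /can_bil mkBilinearE /can_fun lactM diag_mod_one restrE.
Qed.

(** x ⊗ m |-> [x_(1)] ⊗ x_(2) m, taken as the translate of [1] ⊗ m by x, so
    that it is balanced over H by [diag_mod_one]. *)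
Definition canmap : {linear btensor (Uright H) (restr M) -> quotC H ⊗ M} :=
  @blift _ _ (Uright H) (restr M) _ can_bil can_balanced.

Lemma canmapE x m :
  canmap (btens (Uright H) (restr M) x m) = lact (diag_mod C M) x (one \ot m).
Proof. by rewrite [LHS]bliftE mkBilinearE. Qed.

Let proj : {linear U ⊗ M -> btensor (Uright H) (restr M)} :=
  tlift (btens (Uright H) (restr M)).

Let projE x m : proj (x \ot m) = btens (Uright H) (restr M) x m.
Proof. exact: tliftE. Qed.

(** The twist, an isomorphism, covers the canonical map; surjectivity and
    the construction of an inverse are read off from it. *)
Let can_proj z : canmap (proj z) = tmap (cls H) idfun (twist M idfun z).
Proof.
elim/tensor_ind: z => [|y z Ey Ez|x m].
- by rewrite !linear0.
- by rewrite !linearD Ey Ez.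
rewrite projE canmapE twistE diag_modE.
elim/tensor_ind: (comul x) => [|y z Ey Ez|a b].
- by rewrite !linear0 linear0l.
- by rewrite !linearD linearDl Ey Ez.
by rewrite tmap2E !tmapE quotCmodE mulr1 /= orbit_mapE.
Qed.

Let proj_surj z : exists y, proj y = z.
Proof.
elim/btensor_ind: z => [|_ _ [y <-] [z <-]|x m].
- by exists 0; rewrite linear0.
- by exists (y + z); rewrite linearD.
by exists (x \ot m); rewrite projE.
Qed.

Lemma canmap_surj y : exists z, canmap z = y.
Proof.
have [z <-] : exists z, tmap (cls H) (idfun : {linear M -> M}) z = y.
  elim/tensor_ind: y => [|_ _ [y <-] [z <-]|c m].
  - by exists 0; rewrite linear0.
  - by exists (y + z); rewrite linearD.
  by elim/clsW: c => u; exists (u \ot m); rewrite tmapE.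
by exists (proj (twist M antipode z)); rewrite can_proj twist_antipodeK.
Qed.

Let mulr_linear (h : rcs_sub H) : linear (fun x : U => x * val h).
Proof. by move=> a x y; rewrite mulrDl scalerAl. Qed.
Let mulr_by h : {linear U -> U} := mkLinear (mulr_linear h).
Let mulr_byE h x : mulr_by h x = x * val h.
Proof. by rewrite /mulr_by mkLinearE. Qed.

(** x ⊗ m |-> x_(1) ⊗_H S(x_(2)) m, the candidate for the inverse before the
    passage from U to C. *)
Let uncan : {linear U ⊗ M -> btensor (Uright H) (restr M)} :=
  proj \o twist M antipode.

(** By [twist_antipode_act] the left side is x h_(1) ⊗_H S(h_(2)) m, and
    h_(1), which lies in H, moves across to give x ⊗_H h_(1) S(h_(2)) m. *)
Let uncan_act x (h : rcs_sub H) m :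
  uncan (lact (diag_mod (regular U) M) x (val h \ot m)) =
  counit (val h) *: btens (Uright H) (restr M) x m.
Proof.
rewrite /uncan /= twist_antipode_act twistE.
have [w wE] := comul_rcs (valP h).
suff E : proj (tmap (bmul U x) idfun
      (tmap idfun (orbit_map m \o antipode) (tmap inH idfun w))) =
    btens (Uright H) (restr M) x
      (lact M (tlift (bmul U) (tmap idfun antipode (tmap inH idfun w))) m).
  by rewrite -wE E wE antipoder linearZl_LR lact1 linearZr_LR.
elim/tensor_ind: w {wE} => [|y z Ey Ez|g u].
- by rewrite !linear0 !linear0l linear0r.
- by rewrite !linearD !linearDl linearDr Ey Ez.
rewrite 3![in LHS]tmapE projE 2![in RHS]tmapE tliftE /= 2!bmulE.
rewrite orbit_mapE -UrightE.
by rewrite btens_balanced restrE lactM.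
Qed.

(** U ⊗ M is spanned by translates of elements 1 ⊗ m, which right
    multiplication by h turns into translates of h ⊗ m. So [uncan] vanishes
    on U H^+ ⊗ M. *)
Let uncan_mulr (h : rcs_sub H) z : counit (val h) = 0 :> k ->
  uncan (tmap (mulr_by h) idfun z) = 0.
Proof.
move=> h0; rewrite -[z]twist_antipodeK.
elim/tensor_ind: (twist M antipode z) => [|y {}z Ey Ez|x m].
- by rewrite !linear0.
- by rewrite !linearD Ey Ez addr0.
rewrite twist_idE.
have -> : tmap (mulr_by h) idfun (lact (diag_mod (regular U) M) x (1 \ot m)) =
    lact (diag_mod (regular U) M) x (val h \ot m).
  rewrite !diag_modE; elim/tensor_ind: (comul x) => [|y {}z Ey Ez|a b].
  - by rewrite !linear0l linear0.
  - by rewrite !linearDl linearD Ey Ez.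
  by rewrite 2!tmap2E tmapE mulr_byE 2!regularE mulr1.
by rewrite uncan_act h0 scale0r.
Qed.

Let uncan_linl m : linear (fun x : U => uncan (x \ot m)).
Proof. by move=> a x y; rewrite linearPl linearP. Qed.

Let uncan_UHplus m u : UHplus H u -> mkLinear (uncan_linl m) u = 0.
Proof.
case=> x h Hh h0; rewrite mkLinearE.
have := @uncan_mulr (Sub h Hh) (x \ot m) h0.
by rewrite tmapE mulr_byE.
Qed.

(* C is a quotient of U, out of which qlift builds the map below. *)
Transparent cls quotC.
Let uncan_bar m : {linear quotC H -> btensor (Uright H) (restr M)} :=
  qlift (@uncan_UHplus m).
Let uncan_barE m u : uncan_bar m (cls H u) = uncan (u \ot m).
Proof. by rewrite [LHS]qliftE mkLinearE. Qed.
Opaque cls quotC.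

Let uncan_fun (c : quotC H) (m : M) := uncan_bar m c.
Let uncan_linC m : linear (uncan_fun^~ m).
Proof. by move=> a c d; rewrite /uncan_fun linearP. Qed.
Let uncan_linM c : linear (uncan_fun c).
Proof.
move=> a m n; elim/clsW: c => u; rewrite /uncan_fun.
by rewrite !uncan_barE linearPr linearP.
Qed.

Lemma canmap_inj : injective canmap.
Proof.
pose canmap' := tlift (mkBilinear uncan_linC uncan_linM).
suff canK z : canmap' (canmap z) = z by apply: (can_inj canK).
have [{}z <-] := proj_surj z; rewrite can_proj.
have E y : canmap' (tmap (cls H) idfun y) = uncan y.
  elim/tensor_ind: y => [|y {}z Ey Ez|x m].
  - by rewrite !linear0.
  - by rewrite !linearD Ey Ez.
  by rewrite tmapE [LHS]tliftE mkBilinearE /uncan_fun uncan_barE.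
by rewrite E /uncan /= twist_idK.
Qed.

End OneModule.
End Canonical.
Arguments canmap {k U H M}.

Lemma canmap_bmapE (k : fieldType) (U : hopfAlgType k)
    (H : rightCoidealSubalgebra U) (M : leftModule U)
    (N : leftModule (rcs_sub H)) (i : leftModuleHom N (restr H M)) x n :
  canmap (bmap (rhom_id (Uright H)) i (btens (Uright H) N x n)) =
  lact (diag_mod (quotCmod H) M) x (cls H 1 \ot i n).
Proof. by rewrite bmapE canmapE. Qed.

(** * Flatness and the cobar complex *)

Section Flat.
Variables (k : fieldType) (A : algType k) (M : rightModule A).
Variables (N N' : leftModule A) (f : leftModuleHom N N').

Let zero_linear (V W : lmodType k) : linear (fun _ : V => 0 : W).
Proof. by move=> a u v; rewrite scaler0 addr0. Qed.
Let zero_map (V W : lmodType k) : {linear V -> W} :=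
  mkLinear (@zero_linear V W).
Let zero_mapE V W v : zero_map V W v = 0.
Proof. by rewrite /zero_map mkLinearE. Qed.
Let zero_homP (P Q : leftModule A) a m :
  zero_map P Q (lact P a m) = lact Q a (zero_map P Q m).
Proof. by rewrite !zero_mapE linear0r. Qed.
Let zero_hom (P Q : leftModule A) : leftModuleHom P Q :=
  LeftModuleHom (@zero_homP P Q).

(** Injectivity of f is exactness at N of the zero map followed by f. *)
Lemma flat_injective : faithfully_flat_right M ->
  injective f -> injective (bmap (rhom_id M) f).
Proof.
move=> flatM f_inj y z yz; have [ex _] := flatM _ _ _ (zero_hom N N) f.
have {}ex : exact_at (bmap (rhom_id M) (zero_hom N N)) (bmap (rhom_id M) f).
  apply: ex => n; split=> [fn0|[m <-]]; last by rewrite /= zero_mapE linear0.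
  by exists 0; rewrite /= zero_mapE; apply: f_inj; rewrite linear0 fn0.
have /ex[w] : bmap (rhom_id M) f (y - z) = 0 by rewrite linearB yz subrr.
have -> : bmap (rhom_id M) (zero_hom N N) w = 0.
  elim/btensor_ind: w => [|u v Eu Ev|m n]; first exact: linear0.
    by rewrite linearD Eu Ev addr0.
  by rewrite bmapE /= zero_mapE linear0r.
by move/esym/eqP; rewrite subr_eq0 => /eqP.
Qed.

End Flat.

Lemma btensor_ext (k : fieldType) (A : algType k) (M : rightModule A)
    (N : leftModule A) (X : lmodType k) (f g : {linear btensor M N -> X}) :
  (forall m n, f (btens M N m n) = g (btens M N m n)) -> f =1 g.
Proof.
move=> fg; elim/btensor_ind => [|y z fy fz|//]; first by rewrite !linear0.
by rewrite !linearD fy fz.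
Qed.

Section Cobar.
Variables (k : fieldType) (C : coalgType k) (M : lmodType k).
Variable lam : {linear M -> C ⊗ M}.

Let cobar_linear : linear (fun y => tmap (idfun : {linear C -> C}) lam y -
  tassoc C C M (tmap comul idfun y)).
Proof.
by move=> a y z; rewrite linearP linearP linearP /= opprD addrACA -scalerBr.
Qed.

Definition cobar : {linear C ⊗ M -> C ⊗ (C ⊗ M)} := mkLinear cobar_linear.

Lemma cobarE y :
  cobar y = tmap idfun lam y - tassoc C C M (tmap comul idfun y).
Proof. by rewrite /cobar mkLinearE. Qed.

Hypothesis lamA : forall m,
  tassoc C C M (tmap comul idfun (lam m)) = tmap idfun lam (lam m).

(** The counit gives a contracting homotopy: a cocycle y is the coaction of
    (ε ⊗ id) y. *)
Lemma cobar_eq0 y : cobar y = 0 <-> exists m, y = lam m.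
Proof.
rewrite cobarE; split=> [/eqP|[m ->]]; last by rewrite lamA subrr.
rewrite subr_eq0 => /eqP Ey; exists (contractl M counit y).
have -> : lam (contractl M counit y) =
    contractl (C ⊗ M) counit (tmap idfun lam y).
  elim/tensor_ind: y {Ey} => [|u v Eu Ev|c m].
  - by rewrite !linear0.
  - by rewrite !linearD Eu Ev.
  by rewrite tmapE !contractlE linearZ_LR.
rewrite Ey; elim/tensor_ind: y {Ey} => [|u v Eu Ev|c m].
- by rewrite !linear0.
- by rewrite !linearD -Eu -Ev.
rewrite tmapE -{1}(counitl c); elim/tensor_ind: (comul c) => [|u v Eu Ev|a b].
- by rewrite linear0 !linear0l !linear0.
- by rewrite linearD !linearDl !linearD -Eu -Ev.
by rewrite tassocE !contractlE linearZl_LR.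
Qed.
End Cobar.

Section HopfModule.
Variables (k : fieldType) (U : hopfAlgType k) (H : rightCoidealSubalgebra U).

Notation C := (quotCmod H).
Notation one := (cls H 1).

Lemma equivariant_comul : equivariant (M := C) (N := diag_mod C C) comul.
Proof. by move=> x c; rewrite comul_lact diag_modE. Qed.

Lemma equivariant_contractl (M : leftModule U) :
  equivariant (M := diag_mod C M) (N := M)
    (contractl M (counit : {scalar quotC H})).
Proof.
move=> x z; rewrite diag_modE -[in RHS](counitl x).
elim/tensor_ind: (comul x) => [|r s Er Es|a b].
- by rewrite !(linear0, linear0l).
- by rewrite !(linearD, linearDl) Er Es.
elim/tensor_ind: z => [|r s Er Es|c m].
- by rewrite !linear0.
- by rewrite !(linearD, linearDr) Er Es.
rewrite tmap2E !contractlE counit_lact linearZl_LR linearZr_LR.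
by rewrite scalerA.
Qed.

Lemma equivariant_contractr (M : leftModule U) :
  equivariant (M := diag_mod M C) (N := M)
    (contractr M (counit : {scalar quotC H})).
Proof.
move=> x z; rewrite diag_modE -[in RHS](counitr x).
elim/tensor_ind: (comul x) => [|r s Er Es|a b].
- by rewrite !(linear0, linear0l).
- by rewrite !(linearD, linearDl) Er Es.
elim/tensor_ind: z => [|r s Er Es|m c].
- by rewrite !linear0.
- by rewrite !(linearD, linearDr) Er Es.
rewrite tmap2E !contractrE counit_lact linearZl_LR linearZr_LR.
by rewrite scalerA.
Qed.

Variables (M : leftModule U) (lam : {linear M -> quotC H ⊗ M}).
Hypothesis lamU : equivariant (M := M) (N := diag_mod C M) lam.

Let defect_linear : linear (fun m => lam m - one \ot m).
Proof.
by move=> a m n; rewrite linearP linearPr opprD addrACA -scalerBr.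
Qed.
Let defect_map : {linear M -> quotC H ⊗ M} := mkLinear defect_linear.
Let defect_mapE m : defect_map m = lam m - one \ot m.
Proof. by rewrite /defect_map mkLinearE. Qed.
Let defect_homP h m :
  defect_map (lact (restr H M) h m) =
  lact (restr H (diag_mod C M)) h (defect_map m).
Proof.
by rewrite !defect_mapE !restrE lamU linearBr diag_mod_one.
Qed.

(** H-linear by [diag_mod_one], with the coinvariants as kernel. *)
Definition defect : leftModuleHom (restr H M) (restr H (diag_mod C M)) :=
  @LeftModuleHom _ _ (restr H M) (restr H (diag_mod C M)) defect_map
    defect_homP.

Lemma defectE m : defect m = lam m - one \ot m.
Proof. exact: defect_mapE. Qed.

(** On x ⊗ m both sides are the translate by x of [1] ⊗ lam m - [1] ⊗ ([1] ⊗
    m). *)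
Lemma canmap_bmap_defect z :
  canmap (bmap (rhom_id (Uright H)) defect z) = cobar lam (canmap z).
Proof.
pose f : {linear _ -> _} := canmap \o bmap (rhom_id (Uright H)) defect.
pose cobarM : {linear quotC H ⊗ M -> quotC H ⊗ diag_mod C M} := cobar lam.
pose g : {linear _ -> _} := cobarM \o canmap.
suff : f =1 g by exact.
apply: btensor_ext => x m; rewrite /f /g /=.
rewrite /cobarM cobarE bmapE !canmapE defectE linearBr linearBr; congr (_ - _).
  by rewrite (equivariant_tmap (equivariant_idfun C) lamU) tmapE.
have E1 : tmap comul idfun (one \ot m) = (one \ot one) \ot m.
  by rewrite tmapE comul_clsE comul1 tmapE.
apply/esym.
transitivity (tassoc (quotC H) (quotC H) M (lact (diag_mod (diag_mod C C) M) x
    (tmap comul idfun (one \ot m)))).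
  congr (tassoc _ _ _ _).
  exact: (equivariant_tmap equivariant_comul (equivariant_idfun M)).
rewrite E1.
have := equivariant_tassoc (M := C) (N := C) (P := M) x ((one \ot one) \ot m).
by rewrite tassocE.
Qed.

Hypothesis lamA : forall m,
  tassoc (quotC H) (quotC H) M (tmap comul idfun (lam m)) =
  tmap idfun lam (lam m).

(** This expresses the kernel of U ⊗_H defect through the coaction alone,
    and makes exactness after U ⊗_H - accessible. *)
Lemma bmap_defect_eq0 z :
  bmap (rhom_id (Uright H)) defect z = 0 <-> exists m, canmap z = lam m.
Proof.
rewrite -(cobar_eq0 lamA) -canmap_bmap_defect; split=> [->|z0].
  exact: linear0.
by apply: canmap_inj; rewrite z0 linear0.
Qed.

End HopfModule.

(** * Coinvariants of relative Hopf modules *)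

Section Extension.
Variables (k : fieldType) (U : hopfAlgType k) (H : rightCoidealSubalgebra U).
Variables (M : leftModule U) (N : leftModule (rcs_sub H)).
Variable i : leftModuleHom N (restr H M).

Let ext_linl n : linear (fun x : U => lact M x (i n)).
Proof. by move=> a x y; rewrite linearPl. Qed.
Let ext_linr (x : U) : linear (fun n : N => lact M x (i n)).
Proof. by move=> a m n; rewrite linearP linearPr. Qed.
Let ext_bil : {bilinear U -> N -> M} := mkBilinear ext_linl ext_linr.
Let ext_balanced x (h : rcs_sub H) n :
  ext_bil (ract (Uright H) x h) n = ext_bil x (lact N h n).
Proof. by rewrite UrightE /ext_bil mkBilinearE lactM lhomP restrE. Qed.

Definition extension : {linear btensor (Uright H) N -> M} :=
  @blift _ _ (Uright H) N M ext_bil ext_balanced.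

Lemma extensionE x n : extension (btens (Uright H) N x n) = lact M x (i n).
Proof. by rewrite [LHS]bliftE mkBilinearE. Qed.
End Extension.

Section Descent.
Variables (k : fieldType) (U : hopfAlgType k) (H : rightCoidealSubalgebra U).

Notation C := (quotCmod H).
Notation one := (cls H 1).

Variables (M : leftModule U) (lam : {linear M -> quotC H ⊗ M}).
Hypothesis lamU : equivariant (M := M) (N := diag_mod C M) lam.
Hypothesis lamA : forall m,
  tassoc (quotC H) (quotC H) M (tmap comul idfun (lam m)) =
  tmap idfun lam (lam m).
Hypothesis lam1 : forall m, contractl M counit (lam m) = m.

Variables (N : leftModule (rcs_sub H)) (i : leftModuleHom N (restr H M)).
Hypothesis lam_i : forall n, lam (i n) = one \ot i n.
Variable psi : {linear btensor (Uright H) N -> M}.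
Hypothesis psiE : forall x n, psi (btens (Uright H) N x n) = lact M x (i n).

(** lam is U-linear and i n is coinvariant, so that lam (x (i n)) is the
    translate of [1] ⊗ i n by x. *)
Lemma canmap_bmap z : canmap (bmap (rhom_id (Uright H)) i z) = lam (psi z).
Proof.
elim/btensor_ind: z => [|y z Ey Ez|x n].
- by rewrite !linear0.
- by rewrite !linearD Ey Ez.
by rewrite canmap_bmapE psiE lamU lam_i.
Qed.

(** By [canmap_bmap], lam ∘ psi is U ⊗_H i, injective by flatness, followed
    by the canonical isomorphism: psi is injective. The element of U ⊗_H M
    that corresponds to lam m is killed by U ⊗_H defect, so flatness puts it
    in the image of U ⊗_H i; as lam is injective, m is in the image of psi. *)
Lemma extension_bij : faithfully_flat_right (Uright H) -> injective i ->
  exact_at i (defect lamU) -> bijective psi.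
Proof.
move=> flatU i_inj i_exact.
have lam_inj m m' : lam m = lam m' -> m = m'.
  by move=> mm'; rewrite -[m]lam1 mm' lam1.
have psi_inj z z' : psi z = psi z' -> z = z'.
  move=> zz'; apply: (flat_injective flatU i_inj).
  by apply: canmap_inj; rewrite !canmap_bmap zz'.
have psi_surj m : exists z, psi z = m.
  have [z zm] := canmap_surj (lam m).
  have [ex _] := flatU _ _ _ i (defect lamU).
  have [] := ex i_exact z => + _; case.
    by apply/(bmap_defect_eq0 lamU lamA); exists m.
  move=> y yz; exists y; apply: lam_inj.
  by rewrite -canmap_bmap yz.
have [f fK] := choice psi_surj.
by exists f => // z; apply: psi_inj; rewrite fK.
Qed.

(** Faithful flatness allows to test exactness after U ⊗_H -. There the
    kernel of U ⊗_H defect consists of the elements corresponding to some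
    lam m, and m = psi y gives lam m as the image of y. *)
Lemma coinvariants_exact : faithfully_flat_right (Uright H) ->
  (forall m, exists z, psi z = m) -> exact_at i (defect lamU).
Proof.
move=> flatU psi_surj; apply/(flatU _ _ _ i (defect lamU)) => z.
apply: (iff_trans (bmap_defect_eq0 lamU lamA z)); split=> [[m zm]|[y yz]].
  have [y ym] := psi_surj m; exists y.
  by apply: canmap_inj; rewrite canmap_bmap ym zm.
by exists (psi y); rewrite -canmap_bmap yz.
Qed.

End Descent.

(** * The calculus of a quantum tangent space *)

Lemma coactA_transport (k : fieldType) (C : coalgType k) (V W : lmodType k)
    (j : {linear V -> W}) (rho : {linear V -> V ⊗ C})
    (rho' : {linear W -> W ⊗ C}) :
  (forall v, rho' (j v) = tmap j idfun (rho v)) ->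
  (forall v, tassoc V C C (tmap rho idfun (rho v)) =
    tmap idfun comul (rho v)) ->
  forall v, tassoc W C C (tmap rho' idfun (rho' (j v))) =
    tmap idfun comul (rho' (j v)).
Proof.
move=> rho'E rhoA v; rewrite rho'E.
transitivity
  (tassoc W C C (tmap (tmap j idfun) idfun (tmap rho idfun (rho v)))).
  rewrite (tmap_comp j rho') (tmap_comp rho (tmap j idfun)).
  by congr (tassoc _ _ _ _); apply: eq_tmap => // w /=; rewrite rho'E.
rewrite tassoc_tmap rhoA (tmap_comp idfun j comul).
rewrite (tmap_comp j idfun idfun comul).
by apply: eq_tmap => // z; apply: tmap_id.
Qed.

Lemma grouplike_coactA (k : fieldType) (C : coalgType k) (W : lmodType k)
    (lam : {linear W -> C ⊗ W}) (g : C) w :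
  comul g = g \ot g -> lam w = g \ot w ->
  tassoc C C W (tmap comul idfun (lam w)) = tmap idfun lam (lam w).
Proof.
by move=> gE wE; rewrite wE (tmapE comul) (tmapE idfun lam) gE wE tassocE.
Qed.

Lemma tassoc_coinvariant (k : fieldType) (A B V W : lmodType k)
    (j : {linear V -> W}) (lam : {linear W -> A ⊗ W}) (g : A) :
  (forall v, lam (j v) = g \ot j v) ->
  forall z : V ⊗ B, tassoc A W B (tmap lam idfun (tmap j idfun z)) =
    g \ot tmap j idfun z.
Proof.
move=> lam_j; elim/tensor_ind => [|y z Ey Ez|v b].
- by rewrite !linear0.
- by rewrite !linearD Ey Ez.
by rewrite tmapE (tmapE lam) lam_j tassocE.
Qed.

(** The right coaction t |-> t_(1)^+ ⊗ t_(2) of a quantum tangent space is a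
    projection p of the comultiplication. It is coassociative because
    projecting twice changes nothing: (c^+)_(1)^+ ⊗ (c^+)_(2) = c_(1)^+ ⊗
    c_(2). *)
Section ProjectedCoaction.
Variables (k : fieldType) (C : coalgType k) (V : lmodType k).
Variables (j : {linear V -> C}) (p : {linear C -> C}).
Variable rho : {linear V -> V ⊗ C}.
Hypothesis j_inj : injective j.
Hypothesis rhoE : forall v, tmap j idfun (rho v) = tmap p idfun (comul (j v)).
Hypothesis comul_p : forall c,
  tmap p (idfun : {linear C -> C}) (comul (p c)) = tmap p idfun (comul c).

Lemma projected_coactA v :
  tassoc V C C (tmap rho idfun (rho v)) = tmap idfun comul (rho v).
Proof.
apply: (tmap_injl j_inj).
pose q : {linear C -> C ⊗ C} := tmap p idfun \o comul.
have jassoc z : tmap j idfun (tassoc V C C z) =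
    tassoc C C C (tmap (tmap j idfun) idfun z).
  by rewrite tassoc_tmap; apply: eq_tmap => // y; rewrite tmap_idfun.
transitivity (tassoc C C C (tmap q idfun (tmap j idfun (rho v)))).
  rewrite jassoc (tmap_comp rho _ idfun) (tmap_comp j q idfun idfun).
  congr (tassoc _ _ _ _).
  by apply: eq_tmap => // w /=; rewrite rhoE.
rewrite rhoE.
transitivity (tassoc C C C
    (tmap (tmap p idfun) idfun (tmap comul idfun (comul (j v))))).
  rewrite (tmap_comp comul (tmap p idfun) idfun) (tmap_comp p q idfun idfun).
  congr (tassoc _ _ _ _); exact: eq_tmap.
rewrite tassoc_tmap comulA (tmap_comp idfun p comul).
transitivity (tmap p comul (comul (j v))).
  by apply: eq_tmap => // c /=; rewrite tmap_idfun.
transitivity (tmap idfun comul (tmap j idfun (rho v))).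
  by rewrite rhoE (tmap_comp p idfun idfun comul); apply: eq_tmap.
rewrite (tmap_comp j idfun idfun comul) (tmap_comp idfun j comul idfun).
exact: eq_tmap.
Qed.
End ProjectedCoaction.

Section Tangent.
Variables (k : fieldType) (U : hopfAlgType k) (H : rightCoidealSubalgebra U).

Notation C := (quotCmod H).
Notation one := (cls H 1).

Lemma comul_cls1 : comul one = one \ot one.
Proof. by rewrite comul_clsE comul1 tmapE. Qed.

Lemma qplus_tens z :
  tmap (qplus H) (idfun : {linear quotC H -> quotC H}) z =
  z - one \ot contractl (quotC H) counit z.
Proof.
elim/tensor_ind: z => [|u v Eu Ev|c d].
- by rewrite !linear0 addr0.
- by rewrite !linearD Eu Ev addrACA.
by rewrite tmapE contractlE qplusE linearBl linearZl_LR linearZr_LR.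
Qed.

Variable T : quantumTangentSpace H.

Lemma qplus_qts (t : qts_sub T) : qplus H (qts_val T t) = qts_val T t.
Proof. by rewrite qplusE (qts_counit (valP t)) scale0r subr0. Qed.

Lemma qts_coact_counit t : contractr (qts_sub T) counit (qts_coact T t) = t.
Proof.
apply: (@qts_val_inj _ _ _ T).
rewrite -(@contractr_tmap _ _ _ _ _ (qts_val T) idfun counit counit) //.
rewrite qts_coactE (@contractr_tmap _ _ _ _ _ _ _ counit) //.
by rewrite counitr qplus_qts.
Qed.

Lemma qts_coactA t :
  tassoc (qts_sub T) (quotC H) (quotC H)
    (tmap (qts_coact T) idfun (qts_coact T t)) =
  tmap idfun comul (qts_coact T t).
Proof.
apply: (projected_coactA (@qts_val_inj _ _ _ T) (@qts_coactE _ _ _ T)) => c.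
pose q : {linear quotC H -> quotC H ⊗ quotC H} :=
  tmap (qplus H) idfun \o comul.
have q1 : q one = 0 by rewrite /q /= comul_cls1 tmapE qplus_cls1 linear0l.
suff : q (qplus H c) = q c by exact.
by rewrite qplusE (linearB q) (linearZ_LR q) q1 scaler0 subr0.
Qed.

Let W1_act1 (w : W1 T) : w1_act T 1 w = w.
Proof.
elim/w1_ind: w => [|v w Ev Ew|x t]; first exact: linear0r.
  by rewrite linearDr Ev Ew.
by rewrite w1_actE mul1r.
Qed.

Let W1_actM x y (w : W1 T) : w1_act T (x * y) w = w1_act T x (w1_act T y w).
Proof.
elim/w1_ind: w => [|v w Ev Ew|u t]; first by rewrite !linear0r.
  by rewrite !linearDr Ev Ew.
by rewrite !w1_actE mulrA.
Qed.

Definition W1mod : leftModule U := LeftModule W1_act1 W1_actM.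

Lemma W1modE x y t : lact W1mod x (w1 T y t) = w1 T (x * y) t.
Proof. exact: w1_actE. Qed.

Lemma W1_gen (P : W1mod -> Prop) : P 0 ->
  (forall m n, P m -> P n -> P (m + n)) ->
  (forall x t, P (lact W1mod x (w1 T 1 t))) -> forall m, P m.
Proof.
move=> P0 PD Pw; apply: w1_ind => // x t.
by have := Pw x t; rewrite W1modE mulr1.
Qed.

Let lcoact_free x t :
  w1_lcoact T (w1 T x t) = lact (diag_mod C W1mod) x (one \ot w1 T 1 t).
Proof.
have lin : linear (fun y : U => w1 T y t) by move=> a y z; rewrite linearPl.
have linE y : mkLinear lin y = w1 T y t by rewrite mkLinearE.
rewrite (w1_lcoactE x linE).
rewrite diag_modE; elim/tensor_ind: (comul x) => [|u v Eu Ev|y z].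
- by rewrite linear0 linear0l.
- by rewrite linearD linearDl Eu Ev.
by rewrite tmapE tmap2E quotCmodE W1modE !mulr1 linE.
Qed.

Lemma w1_lcoact1 t : w1_lcoact T (w1 T 1 t) = one \ot w1 T 1 t.
Proof. by rewrite lcoact_free lact1. Qed.

Lemma w1_lcoactU :
  equivariant (M := W1mod) (N := diag_mod C W1mod) (w1_lcoact T).
Proof.
move=> x; elim/w1_ind => [|v w Ev Ew|y t].
- by rewrite !linear0.
- by rewrite !linearD Ev Ew.
by rewrite W1modE !lcoact_free lactM.
Qed.

Let rcoact_free x t : w1_rcoact T (w1 T x t) =
  lact (diag_mod W1mod C) x (tmap (w1 T 1) idfun (qts_coact T t)).
Proof.
rewrite w1_rcoactE diag_modE; elim/tensor_ind: (comul x) => [|u v Eu Ev|y z].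
- by rewrite !linear0l.
- by rewrite !linearDl Eu Ev.
elim/tensor_ind: (qts_coact T t) => [|u v Eu Ev|s c].
- by rewrite !linear0.
- by rewrite linearDr tmapD linearDr Eu Ev.
by rewrite tmapE !tmap2E W1modE mulr1.
Qed.

Lemma w1_rcoact1 t :
  w1_rcoact T (w1 T 1 t) = tmap (w1 T 1) idfun (qts_coact T t).
Proof. by rewrite rcoact_free lact1. Qed.

Lemma w1_rcoactU :
  equivariant (M := W1mod) (N := diag_mod W1mod C) (w1_rcoact T).
Proof.
move=> x; elim/w1_ind => [|v w Ev Ew|y t].
- by rewrite !linear0.
- by rewrite !linearD Ev Ew.
by rewrite W1modE !rcoact_free lactM.
Qed.

Lemma w1_codiff1 t : w1_codiff T (w1 T 1 t) = qts_val T t.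
Proof. by rewrite w1_codiffE lact1. Qed.

Lemma w1_codiffU : equivariant (M := W1mod) (N := C) (w1_codiff T).
Proof.
move=> x; elim/w1_ind => [|v w Ev Ew|y t].
- by rewrite !linear0.
- by rewrite !linearD Ev Ew.
by rewrite W1modE !w1_codiffE lactM.
Qed.

Lemma w1_left_comodule : is_left_comodule (tangent_focc T).
Proof.
split; [apply: (generated_lcoactA W1_gen (@equivariant_comul _ _ H) w1_lcoactU)
       |apply: (generated_lcounit W1_gen w1_lcoactU) => [|t]].
- by move=> t; apply: (grouplike_coactA comul_cls1 (w1_lcoact1 t)).
- exact: equivariant_contractl.
by rewrite w1_lcoact1 contractlE counit_clsE counit1 scale1r.
Qed.

Lemma w1_right_comodule : is_right_comodule (tangent_focc T).
Proof.
split; [apply: (generated_rcoactA W1_gen (@equivariant_comul _ _ H) w1_rcoactU)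
       |apply: (generated_rcounit W1_gen w1_rcoactU) => [|t]].
- exact: (coactA_transport w1_rcoact1 qts_coactA).
- exact: equivariant_contractr.
rewrite w1_rcoact1 (@contractr_tmap _ _ _ _ _ (w1 T 1) idfun counit) //.
by rewrite qts_coact_counit.
Qed.

Lemma w1_bicomodule : is_bicomodule (tangent_focc T).
Proof.
split; [exact: w1_left_comodule | exact: w1_right_comodule|].
apply: (generated_bicomodule W1_gen w1_lcoactU w1_rcoactU) => t.
rewrite w1_rcoact1 w1_lcoact1 (tassoc_coinvariant w1_lcoact1).
by rewrite tmapE w1_rcoact1.
Qed.

Lemma w1_coderivation : is_coderivation (tangent_focc T).
Proof.
apply: (generated_coderivation W1_gen (@equivariant_comul _ _ H) w1_lcoactU
  w1_rcoactU w1_codiffU) => t.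
rewrite w1_codiff1 w1_rcoact1 w1_lcoact1 [tmap idfun _ _]tmapE w1_codiff1.
have -> : tmap (w1_codiff T) idfun (tmap (w1 T 1) idfun (qts_coact T t)) =
    tmap (qts_val T) idfun (qts_coact T t).
  rewrite (tmap_comp (w1 T 1) (w1_codiff T) idfun idfun).
  by apply: eq_tmap => // s; apply: w1_codiff1.
by rewrite qts_coactE qplus_tens counitl subrK.
Qed.

Let val_homP (h : rcs_sub H) (t : qts_mod T) :
  qts_val T (lact (qts_mod T) h t) = lact (restr H C) h (qts_val T t).
Proof. by rewrite qts_modE restrE. Qed.

Definition qts_val_hom : leftModuleHom (qts_mod T) (restr H C) :=
  @LeftModuleHom _ _ (qts_mod T) (restr H C) (qts_val T) val_homP.

Let w1_lcoact_codiff x t : tmap idfun (w1_codiff T) (w1_lcoact T (w1 T x t)) =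
  lact (diag_mod C C) x (one \ot qts_val T t).
Proof.
rewrite -[x]mulr1 -W1modE w1_lcoactU w1_lcoact1 mulr1.
by rewrite (equivariant_tmap (equivariant_idfun C) w1_codiffU) tmapE w1_codiff1.
Qed.

(* W1 T is a balanced tensor product, to which the lemmas on U ⊗_H - apply. *)
Transparent W1 w1.
(** The map is U ⊗_H T -> U ⊗_H C, injective by flatness, followed by the
    canonical isomorphism of U ⊗_H C with C ⊗ C. *)
Lemma w1_codiff_inj : faithfully_flat_right (Uright H) ->
  injective (fun w => tmap (idfun : {linear quotC H -> quotC H}) (w1_codiff T)
    (w1_lcoact T w)).
Proof.
move=> flatU v w /= vw; apply: (flat_injective (f := qts_val_hom) flatU).
  exact: qts_val_inj.
apply: canmap_inj.
pose f : {linear W1 T -> quotC H ⊗ quotC H} :=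
  tmap idfun (w1_codiff T) \o w1_lcoact T.
pose g : {linear W1 T -> quotC H ⊗ quotC H} :=
  canmap \o bmap (rhom_id (Uright H)) qts_val_hom.
have fg : f =1 g.
  apply: btensor_ext => x t; rewrite /f /g /=.
  exact: etrans (w1_lcoact_codiff x t) (esym (canmap_bmapE qts_val_hom x t)).
by have := fg v; have := fg w; rewrite /f /g /= vw => -> ->.
Qed.
Opaque W1 w1.

Lemma tangent_focc_equivariant : faithfully_flat_right (Uright H) ->
  is_equivariant_focc (tangent_focc T).
Proof.
move=> flatU; split.
  split; [exact: w1_bicomodule | exact: w1_coderivation | exact: w1_codiff_inj].
split.
- by split; [apply: W1_act1 | apply: W1_actM].
- by move=> x w; have := w1_lcoactU x w; rewrite diag_modE.
- by move=> x w; have := w1_rcoactU x w; rewrite diag_modE.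
exact: w1_codiffU.
Qed.

End Tangent.

(** * Coinvariants of a codifferential calculus *)

Section Coinvariants.
Variables (k : fieldType) (C : coalgType k) (W : foccData C) (g : C).
Hypothesis bicom : is_bicomodule W.
Hypothesis coder : is_coderivation W.
Hypothesis inj : injective
  (fun w => tmap (idfun : {linear C -> C}) (codiff W) (lcoact W w)).

Definition coinvariant (w : W) := lcoact W w = g \ot w.

(** Applying ε ⊗ ε to the coderivation identity gives ε(δ w) = ε(δ w) + ε(δ
    w). *)
Lemma counit_codiff w : counit (codiff W w) = 0 :> k.
Proof.
have [[_ lam1] [_ rho1] _] := bicom.
have El z : contractl C counit (tmap idfun (codiff W) z) =
    codiff W (contractl W counit z).
  elim/tensor_ind: z => [|y z Ey Ez|c v].
  - by rewrite !linear0.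
  - by rewrite !linearD Ey Ez.
  by rewrite tmapE !contractlE linearZ_LR.
have Er z : counit (contractl C counit (tmap (codiff W) idfun z)) =
    counit (codiff W (contractr W counit z)) :> k.
  elim/tensor_ind: z => [|y z Ey Ez|v c].
  - by rewrite !linear0.
  - by rewrite !linearD Ey Ez.
  by rewrite tmapE contractlE contractrE !linearZ_LR /= mulrC.
have := counitl (codiff W w); rewrite coder linearD El lam1.
move/eqP; rewrite -subr_eq0 addrK => /eqP E.
by rewrite -{1}(rho1 w) -Er E linear0.
Qed.

Lemma coinvariantP a u v : coinvariant u -> coinvariant v ->
  coinvariant (a *: u + v).
Proof. by rewrite /coinvariant => uE vE; rewrite linearP uE vE linearPr. Qed.

Let defect_linear : linear (fun w => lcoact W w - g \ot w).
Proof.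
by move=> a m n; rewrite linearP linearPr opprD addrACA -scalerBr.
Qed.
Let defect : {linear W -> C ⊗ W} := mkLinear defect_linear.
Let defectE w : defect w = lcoact W w - g \ot w.
Proof. by rewrite /defect mkLinearE. Qed.
Let defectP w : defect w = 0 <-> coinvariant w.
Proof.
rewrite defectE; split=> [/eqP|->]; last exact: subrr.
by rewrite subr_eq0 => /eqP.
Qed.

(** On coinvariants w_(-1) ⊗ δ(w_(0)) is g ⊗ δ w, so that the injectivity
    required of a calculus makes δ injective there. *)
Lemma coinvariant_section : exists h : {linear C -> W},
  forall w, coinvariant w -> h (codiff W w) = w.
Proof.
have [|h hK] := @kernel_section _ _ _ defect _ (codiff W).
  move=> v /defectP vE dv; apply: inj; rewrite vE !linear0 tmapE dv.
  exact: linear0r.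
by exists h => w /defectP; apply: hK.
Qed.

(** As the coactions commute, (lam ⊗ id) (rho w) = g ⊗ rho w for w
    coinvariant: rho w is in the kernel of (lam - g ⊗ -) ⊗ id, and tensoring
    over a field is exact. The projection p expresses that w_(0) may be
    taken coinvariant without forming a subspace. *)
Lemma coinvariant_projection : exists p : {linear W -> W},
  (forall v, coinvariant (p v)) /\
  forall w, coinvariant w -> tmap p idfun (rcoact W w) = rcoact W w.
Proof.
have [p [pE pK]] := kernel_projection defect.
exists p; split=> [v|w wE]; first exact/defectP.
apply: pK; have [_ _ bi] := bicom.
apply: (@tassoc_inj _ C W C); rewrite linear0.
have -> z : tassoc C W C (tmap defect idfun z) =
    tassoc C W C (tmap (lcoact W) idfun z) - g \ot z.
  elim/tensor_ind: z => [|y z Ey Ez|v c].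
  - by rewrite !linear0 addr0.
  - by rewrite !linearD /= Ey Ez addrACA.
  rewrite [tmap defect _ _]tmapE [tmap (lcoact W) _ _]tmapE defectE.
  by rewrite linearBl linearB tassocE.
by rewrite bi wE tmapE subrr.
Qed.
(** Recovers the right coaction of a coinvariant from δ(w_(0)) ⊗ w_(1),
    which the coderivation identity computes from the comultiplication of C. *)
Lemma coinvariant_rcoact (h : {linear C -> W}) w :
  (forall v, coinvariant v -> h (codiff W v) = v) -> coinvariant w ->
  tmap h idfun (tmap (codiff W) idfun (rcoact W w)) = rcoact W w.
Proof.
move=> hK wE; have [p [pE pK]] := coinvariant_projection.
rewrite -(pK w wE) (tmap_comp p (codiff W)) (tmap_comp _ h).
by apply: eq_tmap => // v /=; apply: hK.
Qed.
End Coinvariants.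

(** * The quantum tangent space of a calculus *)

Section Reconstruction.
Variables (k : fieldType) (U : hopfAlgType k) (H : rightCoidealSubalgebra U).
Variable W : equivariantFoccData H.
Hypothesis W_focc : is_equivariant_focc W.

Notation C := (quotCmod H).
Notation one := (cls H 1).

Let W_act1 w : efocc_act W 1 w = w.
Proof. by case: W_focc => _ [[a1 _] _ _ _]; apply: a1. Qed.
Let W_actM x y w : efocc_act W (x * y) w = efocc_act W x (efocc_act W y w).
Proof. by case: W_focc => _ [[_ aM] _ _ _]; apply: aM. Qed.

Definition efocc_mod : leftModule U := LeftModule W_act1 W_actM.

Lemma efocc_lcoactU :
  equivariant (M := efocc_mod) (N := diag_mod C efocc_mod) (lcoact W).
Proof. by case: W_focc => _ [_ lU _ _] x w; rewrite diag_modE; apply: lU. Qed.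

Lemma efocc_rcoactU :
  equivariant (M := efocc_mod) (N := diag_mod efocc_mod C) (rcoact W).
Proof. by case: W_focc => _ [_ _ rU _] x w; rewrite diag_modE; apply: rU. Qed.

Lemma efocc_codiffU : equivariant (M := efocc_mod) (N := C) (codiff W).
Proof. by case: W_focc => _ [_ _ _ dU]; apply: dU. Qed.

Let bicom : is_bicomodule W. Proof. by case: W_focc => -[]. Qed.
Let left_comod : is_left_comodule W. Proof. by case: bicom. Qed.
Let coder : is_coderivation W. Proof. by case: W_focc => -[]. Qed.
Let codiff_inj : injective (fun w =>
  tmap (idfun : {linear quotC H -> quotC H}) (codiff W) (lcoact W w)).
Proof. by case: W_focc => -[]. Qed.

Let coinv (w : W) := coinvariant one w.

Let coinv0 : coinv 0.
Proof. by rewrite /coinv /coinvariant linear0 linear0r. Qed.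

Let coinv_act (h : rcs_sub H) w : coinv w -> coinv (lact efocc_mod (val h) w).
Proof.
rewrite /coinv /coinvariant => wE.
by have := efocc_lcoactU (val h) w; rewrite wE diag_mod_one.
Qed.

Definition codiff_coinv : {pred quotC H} :=
  fun c => `[< exists2 w, coinv w & codiff W w = c >].

Lemma codiff_coinvP c :
  reflect (exists2 w, coinv w & codiff W w = c) (c \in codiff_coinv).
Proof. exact: asboolP. Qed.

Let codiff_coinv_submod : GRing.submod_closed codiff_coinv.
Proof.
split=> [|a _ _ /codiff_coinvP[u uE <-] /codiff_coinvP[v vE <-]].
  by apply/codiff_coinvP; exists 0; rewrite ?linear0 //; apply: coinv0.
by apply/codiff_coinvP; exists (a *: u + v); rewrite ?linearP //;
  apply: coinvariantP.
Qed.

Let codiff_coinv_counit c : c \in codiff_coinv -> counit c = 0 :> k.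
Proof. by case/codiff_coinvP => w _ <-; apply: counit_codiff. Qed.

(** For w coinvariant, Δ(δ w) = δ(w_(0)) ⊗ w_(1) + [1] ⊗ δ w with w_(0)
    coinvariant. *)
Let codiff_coinv_comul c : c \in codiff_coinv ->
  comul c \in
    tspan [set s + a *: one | s in [set` codiff_coinv] & a in [set: k]]%classic
      [set: quotC H]%classic.
Proof.
case/codiff_coinvP => w wE <-; rewrite coder wE.
have [p [pE pK]] := coinvariant_projection one bicom.
rewrite -(pK w wE) tmapE rpredD //; last first.
  apply: mem_span; exists one; last by exists (codiff W w).
  exists 0; last by exists 1 => //; rewrite scale1r add0r.
  by apply/codiff_coinvP; exists 0; rewrite ?linear0 //; apply: coinv0.
elim/tensor_ind: (rcoact W w) => [|y z Ey Ez|v c'].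
- by rewrite !linear0 rpred0.
- by rewrite !linearD rpredD.
rewrite !tmapE; apply: mem_span; exists (codiff W (p v)); last by exists c'.
exists (codiff W (p v)); last by exists 0 => //; rewrite scale0r addr0.
by apply/codiff_coinvP; exists (p v) => //; apply: pE.
Qed.

Let codiff_coinv_stable h c : h \in rcs_pred H -> c \in codiff_coinv ->
  lact C h c \in codiff_coinv.
Proof.
move=> Hh /codiff_coinvP[w wE <-]; apply/codiff_coinvP.
exists (lact efocc_mod h w); first exact: (@coinv_act (Sub h Hh)).
exact: efocc_codiffU.
Qed.

Definition coinv_tangent : quantumTangentSpace H :=
  @QuantumTangentSpace _ _ H codiff_coinv codiff_coinv_submod
    codiff_coinv_counit codiff_coinv_comul codiff_coinv_stable.

Let T := coinv_tangent.

(* W1 T is a balanced tensor product, to which the lemmas on U ⊗_H - apply. *)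
Transparent W1 w1.
(** δ is a bijection from the coinvariants onto T. Its inverse i extends to
    a U-linear map psi from U ⊗_H T, bijective by [extension_bij], and the
    compatibilities of psi need checking on the elements 1 ⊗ t only. For the
    right coaction, both sides are determined by δ(w_(0)) ⊗ w_(1). *)
Lemma tangent_focc_coinv : faithfully_flat_right (Uright H) ->
  efocc_iso (tangent_focc T) W.
Proof.
move=> flatU.
have [h hK] := coinvariant_section one codiff_inj.
pose i : {linear qts_sub T -> W} := h \o qts_val T.
have itE t : i t = h (qts_val T t) by [].
have iP t : coinv (i t) /\ codiff W (i t) = qts_val T t.
  have [w wE] : exists2 w, coinv w & codiff W w = qts_val T t.
    exact/codiff_coinvP/(valP t).
  by move=> wt; rewrite itE -wt hK.
have i_homP g t : i (lact (qts_mod T) g t) =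
    lact (restr H efocc_mod) g (i t).
  have [it_coinv dit] := iP t.
  rewrite restrE -(hK _ (coinv_act g it_coinv)) itE qts_modE.
  by rewrite efocc_codiffU -dit.
pose ih : leftModuleHom (qts_mod T) (restr H efocc_mod) :=
  @LeftModuleHom _ _ (qts_mod T) (restr H efocc_mod) i i_homP.
pose psi : {linear W1 T -> W} := extension ih.
have psiE x t : psi (w1 T x t) = efocc_act W x (i t).
  exact: (extensionE ih x t).
have psi1 t : psi (w1 T 1 t) = i t by rewrite psiE W_act1.
have psiU : equivariant (M := W1mod T) (N := efocc_mod) psi.
  move=> x; apply: (W1_gen (T := T)) => [|v w Ev Ew|y t].
  - by rewrite !linear0.
  - by rewrite !linearD Ev Ew.
  by rewrite !W1modE mulr1 !psiE W_actM.
exists psi; split.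
- apply: (@extension_bij _ _ _ efocc_mod (lcoact W) efocc_lcoactU _ _
    (qts_mod T) ih).
  + exact: left_comod.1.
  + exact: left_comod.2.
  + by move=> t; case: (iP t).
  + exact: extensionE.
  + exact: flatU.
  + move=> s t /(congr1 (codiff W)); rewrite /= (iP s).2 (iP t).2.
    exact: qts_val_inj.
  move=> w; rewrite defectE; split=> [/eqP|[t <-]]; last first.
    by rewrite /= (iP t).1 subrr.
  rewrite subr_eq0 => /eqP wE.
  have Tw : codiff W w \in codiff_coinv by apply/codiff_coinvP; exists w.
  pose t : qts_sub T := exist _ (codiff W w) Tw.
  by exists t; exact: hK.
- exact: psiU.
- apply: (generated_lcolinear (@W1_gen _ _ _ T) psiU (@w1_lcoactU _ _ _ T)
    efocc_lcoactU) => t.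
  by rewrite psi1 w1_lcoact1 (iP t).1 tmapE psi1.
- apply: (generated_rcolinear (@W1_gen _ _ _ T) psiU (@w1_rcoactU _ _ _ T)
    efocc_rcoactU) => t.
  rewrite psi1 w1_rcoact1.
  have [it_coinv dit] := iP t.
  rewrite -(coinvariant_rcoact bicom hK it_coinv).
  have -> : tmap (codiff W) idfun (rcoact W (i t)) =
      tmap (qts_val T) idfun (qts_coact T t).
    rewrite qts_coactE qplus_tens counitl -dit coder it_coinv tmapE.
    by rewrite addrK.
  rewrite (tmap_comp (qts_val T) h) (tmap_comp (w1 T 1) psi).
  by apply: eq_tmap => // s; rewrite /= psi1.
apply: (W1_gen (T := T)) => [|v w Ev Ew|x t].
- by rewrite !linear0.
- by rewrite !linearD Ev Ew.
by rewrite psiU psi1 efocc_codiffU w1_codiffU w1_codiff1 (iP t).2.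
Qed.
Opaque W1 w1.

End Reconstruction.

(** * Classification *)

Section Classification.
Variables (k : fieldType) (U : hopfAlgType k) (H : rightCoidealSubalgebra U).

Notation C := (quotCmod H).
Notation one := (cls H 1).

(* W1 T is a balanced tensor product, to which the lemmas on U ⊗_H - apply. *)
Transparent W1 w1.
(** [coinvariants_exact] for the relative Hopf module U ⊗_H T itself. *)
Lemma tangent_coinvariants (T : quantumTangentSpace H) (w : W1 T) :
  faithfully_flat_right (Uright H) ->
  w1_lcoact T w = one \ot w -> exists t, w1 T 1 t = w.
Proof.
move=> flatU wE.
have i_homP h t : w1 T 1 (lact (qts_mod T) h t) =
    lact (restr H (W1mod T)) h (w1 T 1 t).
  by rewrite -w1_balanced restrE W1modE mul1r mulr1.
pose i := @LeftModuleHom _ _ (qts_mod T) (restr H (W1mod T)) (w1 T 1) i_homP.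
pose psi : {linear btensor (Uright H) (qts_mod T) -> W1mod T} := idfun.
have psiE x t : psi (btens (Uright H) (qts_mod T) x t) =
    lact (W1mod T) x (i t) by rewrite W1modE mulr1.
have left_comod := w1_left_comodule T.
have ex := @coinvariants_exact _ _ _ (W1mod T) (w1_lcoact T)
  (@w1_lcoactU _ _ _ T) left_comod.1 _ i (@w1_lcoact1 _ _ _ T) psi psiE flatU
  (fun m => ex_intro _ m erefl).
have [+ _] := ex w; case; last by move=> t <-; exists t.
by rewrite defectE wE subrr.
Qed.
Opaque W1 w1.

Lemma efocc_iso_refl (W : equivariantFoccData H) : efocc_iso W W.
Proof.
exists idfun; split=> // [|w|w]; first by exists idfun.
- by rewrite [RHS]tmap_id.
by rewrite [RHS]tmap_id.
Qed.

Lemma efocc_iso_sym (W W' : equivariantFoccData H) :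
  efocc_iso W W' -> efocc_iso W' W.
Proof.
case=> f [[g fK gK] fU fl fr fd].
have g_lin : linear g by apply: (can2_linear fK gK).
pose h : {linear W' -> W} := mkLinear g_lin.
have hE w : h w = g w by rewrite /h mkLinearE.
have fhK w : h (f w) = w by rewrite hE.
have hfK w : f (h w) = w by rewrite hE.
exists h; split=> [|x w|w|w|w].
- by exists f.
- by apply: (can_inj fhK); rewrite fU !hfK.
- rewrite -{2}(hfK w) fl (tmap_comp idfun idfun f h).
  by rewrite [RHS]tmap_id.
- rewrite -{2}(hfK w) fr (tmap_comp f h idfun idfun).
  by rewrite [RHS]tmap_id.
by rewrite -fd hfK.
Qed.

Lemma efocc_iso_trans (W W' W'' : equivariantFoccData H) :
  efocc_iso W W' -> efocc_iso W' W'' -> efocc_iso W W''.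
Proof.
case=> f [f_bij fU fl fr fd] [g [g_bij gU gl gr gd]].
exists (g \o f); split=> [|x w|w|w|w] /=; first exact: bij_comp.
- by rewrite fU gU.
- by rewrite gl fl (tmap_comp idfun idfun f g); apply: eq_tmap.
- by rewrite gr fr (tmap_comp f g idfun idfun); apply: eq_tmap.
by rewrite gd fd.
Qed.

Lemma iso_class_eq (W W' : equivariantFoccData H) :
  efocc_iso W W' -> iso_class W = iso_class W'.
Proof.
move=> WW'; apply/funext => V; apply/propext; split=> -[VE iso]; split=> //.
  exact: efocc_iso_trans (efocc_iso_sym WW') iso.
exact: efocc_iso_trans WW' iso.
Qed.

Lemma isoClass_ext (c c' : isoClass H) :
  iso_class_mem c = iso_class_mem c' -> c = c'.
Proof.
case: c c' => [P hP] [Q hQ] /= PQ.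
by rewrite PQ in hP *; rewrite (Prop_irrelevance hP hQ).
Qed.

Lemma quantumTangentSpace_ext (T T' : quantumTangentSpace H) :
  (forall c, (c \in qts_pred T) = (c \in qts_pred T')) -> T = T'.
Proof.
move=> TT'; have {TT'} : qts_pred T = qts_pred T' by apply/funext/TT'.
case: T T' => [P p1 p2 p3 p4] [Q q1 q2 q3 q4] /= PQ.
rewrite PQ in p1 p2 p3 p4 *.
by rewrite (Prop_irrelevance p1 q1) (Prop_irrelevance p2 q2)
  (Prop_irrelevance p3 q3) (Prop_irrelevance p4 q4).
Qed.

(** An isomorphism preserves coinvariants and δ, and T is the image under δ
    of the coinvariants 1 ⊗ t. *)
Lemma efocc_iso_tangent_sub (T T' : quantumTangentSpace H) :
  faithfully_flat_right (Uright H) ->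
  efocc_iso (tangent_focc T) (tangent_focc T') ->
  forall c, c \in qts_pred T -> c \in qts_pred T'.
Proof.
move=> flatU [f [_ _ fl _ fd]] c Tc.
pose t : qts_sub T := exist _ c Tc.
have [|t' t'E] := @tangent_coinvariants T' (f (w1 T 1 t)) flatU.
  by have := fl (w1 T 1 t); rewrite /= w1_lcoact1 tmapE.
have := fd (w1 T 1 t); rewrite /= -t'E !w1_codiff1.
by move=> tt'; have := valP t'; rewrite [val t']tt'.
Qed.

End Classification.

Theorem theorem5p6 (k : fieldType) (U : hopfAlgType k)
    (H : rightCoidealSubalgebra U)
    (char_k : 2%N \notin [pchar k])
    (flat_left : faithfully_flat_left (Uleft H))
    (flat_right : faithfully_flat_right (Uright H)) :
  exists F : quantumTangentSpace H -> isoClass H,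
    (forall T : quantumTangentSpace H, F T (tangent_focc T)) /\ bijective F.
Proof.
pose F (T : quantumTangentSpace H) : isoClass H := IsoClass (ex_intro2 _ _
  (tangent_focc T) (tangent_focc_equivariant T flat_right) erefl).
have FT (T : quantumTangentSpace H) : F T (tangent_focc T).
  by split; [apply: tangent_focc_equivariant|apply: efocc_iso_refl].
exists F; split=> //.
have F_inj T T' : F T = F T' -> T = T'.
  move=> FTT'; apply: quantumTangentSpace_ext => c.
  have [_ iso] : F T' (tangent_focc T) by rewrite -FTT'; apply: FT.
  apply/idP/idP; last exact: efocc_iso_tangent_sub.
  exact: (efocc_iso_tangent_sub flat_right (efocc_iso_sym iso)).
have F_surj c : exists T, F T = c.
  have [W W_focc cE] := iso_classP c.
  exists (coinv_tangent W_focc); apply: isoClass_ext; rewrite cE.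
  exact/iso_class_eq/tangent_focc_coinv.
have [G GK] := choice F_surj.
by exists G => // T; apply: F_inj; rewrite GK.
Qed.
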